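(* Let $K$ be a compact Hausdorff space that contains a Cantor set as a subspace. Then there exists a uniform algebra $A$ on $K$ such that $\mathfrak{M}_A\setminus K\neq\emptyset$ but $\mathfrak{M}_A$ contains no analytic discs.
   Context: A uniform algebra on a compact Hausdorff space $K$ is a closed subalgebra of $C(K)$ (supremum norm) that contains the constants and separates points of $K$. $\mathfrak{M}_A$ denotes the maximal ideal space of $A$ (the space of nonzero multiplicative linear functionals with the Gelfand topology); $K$ is regarded as a subset of $\mathfrak{M}_A$ via point evaluations. An analytic disc in $\mathfrak{M}_A$ is an injective map $\sigma:D\to\mathfrak{M}_A$ ($D$ the open unit disc) such that $\hat f\circ\sigma$ is holomorphic on $D$ for every $f\in A$, where $\hat f$ is the Gelfand transform; $\mathfrak{M}_A$ contains no analytic discs if no such map exists. *)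

(* Defs.v *)
From Stdlib Require Import Reals List.
Open Scope R_scope.

Definition Cpx : Type := (R * R)%type.
Definition Cplus (z w : Cpx) : Cpx := (fst z + fst w, snd z + snd w).
Definition Copp (z : Cpx) : Cpx := (- fst z, - snd z).
Definition Cminus (z w : Cpx) : Cpx := Cplus z (Copp w).
Definition Cmult (z w : Cpx) : Cpx :=
  (fst z * fst w - snd z * snd w, fst z * snd w + snd z * fst w).
Definition C0 : Cpx := (0, 0).
Definition C1 : Cpx := (1, 0).
Definition Cnorm (z : Cpx) : R := sqrt (fst z * fst z + snd z * snd z).

Definition is_topology {X : Type} (T : (X -> Prop) -> Prop) : Prop :=
  T (fun _ => True) /\
  (forall U V, T U -> T V -> T (fun x => U x /\ V x)) /\
  (forall (I : Type) (U : I -> X -> Prop),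
      (forall i, T (U i)) -> T (fun x => exists i, U i x)).

Definition compact_space {X : Type} (T : (X -> Prop) -> Prop) : Prop :=
  forall (I : Type) (U : I -> X -> Prop),
    (forall i, T (U i)) -> (forall x, exists i, U i x) ->
    exists l : list I, forall x, exists i, In i l /\ U i x.

Definition hausdorff {X : Type} (T : (X -> Prop) -> Prop) : Prop :=
  forall x y : X, x <> y ->
    exists U V, T U /\ T V /\ U x /\ V y /\ (forall z, ~ (U z /\ V z)).

Definition cantor_open (U : (nat -> bool) -> Prop) : Prop :=
  forall s, U s -> exists n : nat,
    forall t, (forall k, (k < n)%nat -> t k = s k) -> U t.

Definition contains_cantor_set {X : Type} (T : (X -> Prop) -> Prop) : Prop :=
  exists e : (nat -> bool) -> X,
    (forall W, T W -> cantor_open (fun s => W (e s))) /\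
    (forall s t, e s = e t -> s = t) /\
    (forall V, cantor_open V ->
       exists W, T W /\ forall s, V s <-> W (e s)).

Definition continuousC {X : Type} (T : (X -> Prop) -> Prop) (f : X -> Cpx) : Prop :=
  forall x eps, 0 < eps ->
    exists U, T U /\ U x /\ forall y, U y -> Cnorm (Cminus (f y) (f x)) < eps.

Definition uniform_algebra {X : Type} (T : (X -> Prop) -> Prop)
    (A : (X -> Cpx) -> Prop) : Prop :=
  (forall f, A f -> continuousC T f) /\
  (forall c : Cpx, A (fun _ => c)) /\
  (forall f g, A f -> A g -> A (fun x => Cplus (f x) (g x))) /\
  (forall f g, A f -> A g -> A (fun x => Cmult (f x) (g x))) /\
  (forall x y : X, x <> y -> exists f, A f /\ f x <> f y) /\
  (forall (fn : nat -> X -> Cpx) (f : X -> Cpx),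
     (forall n, A (fn n)) ->
     (forall eps, 0 < eps -> exists N, forall n x, (N <= n)%nat ->
         Cnorm (Cminus (fn n x) (f x)) < eps) ->
     A f).

(** A point of the maximal ideal space: a nonzero multiplicative
    (complex-)linear functional on [A]. Only its values on [A] matter. *)
Definition character {X : Type} (A : (X -> Cpx) -> Prop)
    (phi : (X -> Cpx) -> Cpx) : Prop :=
  (forall f g, A f -> A g -> phi (fun x => Cplus (f x) (g x)) = Cplus (phi f) (phi g)) /\
  (forall (c : Cpx) f, A f -> phi (fun x => Cmult c (f x)) = Cmult c (phi f)) /\
  (forall f g, A f -> A g -> phi (fun x => Cmult (f x) (g x)) = Cmult (phi f) (phi g)) /\
  (exists f, A f /\ phi f <> C0).

(** [phi] is the point evaluation at some point of [X], i.e. [phi] lies in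
    the copy of [X] inside the maximal ideal space. *)
Definition is_point_evaluation {X : Type} (A : (X -> Cpx) -> Prop)
    (phi : (X -> Cpx) -> Cpx) : Prop :=
  exists x : X, forall f, A f -> phi f = f x.

Definition in_disc (z : Cpx) : Prop := Cnorm z < 1.

Definition holomorphic_on_disc (h : Cpx -> Cpx) : Prop :=
  forall z, in_disc z -> exists l : Cpx,
    forall eps, 0 < eps -> exists delta, 0 < delta /\
      forall w, in_disc w -> Cnorm (Cminus w z) < delta ->
        Cnorm (Cminus (Cminus (h w) (h z)) (Cmult l (Cminus w z)))
          <= eps * Cnorm (Cminus w z).

(** An analytic disc in the maximal ideal space of [A]: an injective map
    from the open disc into the maximal ideal space such that every Gelfand
    transform composed with it is holomorphic. Characters are identified
    when they agree on [A]. *)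
Definition analytic_disc {X : Type} (A : (X -> Cpx) -> Prop)
    (sigma : Cpx -> (X -> Cpx) -> Cpx) : Prop :=
  (forall z, in_disc z -> character A (sigma z)) /\
  (forall z w, in_disc z -> in_disc w ->
     (forall f, A f -> sigma z f = sigma w f) -> z = w) /\
  (forall f, A f -> holomorphic_on_disc (fun z => sigma z f)).

(* Main.v *)
(** Let [E] be a Cantor set in [K], with points coded by a doubly indexed array of digits
    together with a sequence of signs.  A row [x] of digits is the binary expansion of an angle,
    hence gives a point [circ x] of the unit circle.  On [E] put [z_0 = circ (row 0)] and
    [z_(n+1) = (1 + d_n) circ (row (n+1))], where [d_n] is the [n]-th digit in an enumeration in
    which it lies in a row [<= n].  The moduli of the [z_n] reveal every digit, so the [z_n] tell
    apart all arrays; on the other hand, filling in the circles one after the other starting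
    from the last one, the maximum principle shows [|p(0)| <= sup |p(z)|] for every polynomial
    [p], although [|z_0| = 1].  Next adjoin square roots [w] of [z_k - a] for all [k] and all [a]
    in a countable dense set, with their signs read off the sign sequence; averaging over the
    signs, the inequality extends to polynomials in the [z_k] and [w].  The algebra consists
    of the continuous functions on [K] whose restriction to [E] is a uniform limit of such
    polynomials, and evaluation at the origin is a character that is not a point of [K].

    Along an analytic disc, continuous real functions vanishing on [E] are real valued, hence
    constant; if one of them is not zero, then every function of the algebra is constant on the
    disc.  Otherwise let [F] be the restriction of some [z_k] to the disc.  If [F'] does not
    vanish at some point, choose [a] close to the value of [F] there: [F - a] winds once around 0
    along a small circle, so it has no continuous square root, contradicting the existence of
    [w].  So the [z_k], then the [w], and finally all functions are constant on the disc. *)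

Require Import Defs.
From HB Require structures.
From mathcomp Require all_boot all_order all_algebra.
From mathcomp Require boolp classical_sets reals topology normedtype numfun.
From mathcomp Require Rstruct Rstruct_topology.
From Stdlib Require Import Reals List Lra Lia Psatz ZArith Arith Cantor.
From Stdlib Require Import Classical ClassicalEpsilon FunctionalExtensionality
  PropExtensionality.
From Coquelicot Require Import Coquelicot.

Open Scope R_scope.

(** * Tietze extension for a topology given by its open sets *)

Module Tietze.
Import structures.
Import all_boot all_order all_algebra.
Import boolp classical_sets reals topology normedtype numfun.
Import Rstruct Rstruct_topology.
Import Order.TTheory GRing.Theory Num.Theory numFieldNormedType.Exports.
Local Open Scope classical_set_scope.

(** The proof of [is_topology T] is a phantom parameter, so that the canonical topological structure
    can be attached to a type that mentions [T]. *)
Definition carrier (K : Type) (T : (K -> Prop) -> Prop) (_ : is_topology T) : Type := K.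

Arguments carrier {K T} _.

Section Carrier.
Variables (K : Type) (T : (K -> Prop) -> Prop) (HT : is_topology T).
Local Notation X := (carrier HT).

HB.instance Definition _ := gen_eqMixin X.
HB.instance Definition _ := gen_choiceMixin X.

Let opT : T setT.
Proof. by case: HT. Qed.

Let opI : setI_closed T.
Proof. by have [_ [H _]] := HT; move=> A B; exact: H. Qed.

Let op_bigU (I : Type) (f : I -> set X) : (forall i, T (f i)) -> T (\bigcup_i f i).
Proof.
have [_ [_ H]] := HT; move=> oT.
have -> : \bigcup_i f i = (fun x => exists i, f i x).
  by rewrite predeqE => x; split=> [[i _]|[i]]; exists i.
exact: H.
Qed.

HB.instance Definition _ := @isOpenTopological.Build X T opT opI op_bigU.

(** From covers to filters: if the proper filter [F] had no cluster point, the open sets whose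
    complement lies in [F] would cover the space, and a finite subcover would put the empty set into
    [F]. *)
Lemma carrier_compact : compact_space T -> compact [set: X].
Proof.
move=> cT F PF _; apply: contrapT => noclus.
pose J := {U : set X | T U /\ F (~` U)}.
have [l lP] : exists l : list J, forall x, exists i, In i l /\ sval i x.
  apply: cT => [[U []//]|x].
  apply: contrapT => nU; apply: noclus; exists x; split => // B C FB.
  rewrite nbhsE => -[U [oU Ux] UC]; apply: contrapT => BC.
  apply: nU; have FU : F (~` U).
    by apply: filterS FB => y By Uy; apply: BC; exists y; split => //; exact: UC.
  by exists (exist _ U (conj oU FU)).
have : F (fun x => forall i, In i l -> ~ sval i x).
  elim: l {lP} => [|i l IH]; first exact: filterS filterT.
  apply: filterS (filterI (svalP i).2 IH) => x [ix lx] j /= [<-//|]; exact: lx.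
by move/filter_ex => [x]; have [i [il ix]] := lP x; move=> /(_ i il).
Qed.

Lemma carrier_hausdorff : hausdorff T -> hausdorff_space X.
Proof.
move=> hT; rewrite open_hausdorff => x y /eqP xy.
have [U [V [oU [oV [Ux [Vy UV]]]]]] := hT x y xy.
exists (U, V); first by rewrite !inE.
split => //=; apply/eqP; rewrite predeqE => z; split => // -[? ?].
by case: (UV z).
Qed.

End Carrier.

Lemma continuous_extension (K : Type) (T : (K -> Prop) -> Prop) (F : K -> Prop)
    (f : K -> R) (M : R) :
  is_topology T -> compact_space T -> hausdorff T ->
  T (fun x => ~ F x) ->
  (forall x, F x -> Rle (Rabs (f x)) M) ->
  (forall x eps, F x -> Rlt 0 eps ->
     exists U, T U /\ U x /\ forall y, U y -> F y -> Rlt (Rabs (f y - f x)) eps) ->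
  exists g : K -> R, (forall x, F x -> g x = f x) /\
   (forall x eps, Rlt 0 eps ->
     exists U, T U /\ U x /\ forall y, U y -> Rlt (Rabs (g y - g x)) eps).
Proof.
move=> HT cT hT cF fM fc.
pose X := carrier HT.
have nX : normal_space X.
  by apply: compact_normal; [exact: carrier_hausdorff|exact: carrier_compact].
have clF : closed (F : set X) by rewrite -openC.
(* The extension theorem asks for a positive bound, which [M] need not be. *)
pose M' := (Num.max M 1)%R.
have M'0 : (0 < M')%R by rewrite lt_max ltr01 orbT.
have fwc : {within (F : set X), continuous (f : X -> R^o)}.
  apply/subspace_continuousP => x Fx; apply/cvgrPdist_lt => e /RltP e0.
  have [U [oU [Ux Uf]]] := fc x e Fx e0.
  have nU : nbhs (x : X) U by apply: open_nbhs_nbhs; split.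
  rewrite near_withinE; apply: filterS nU => y Uy Fy.
  by rewrite distrC -RminusE -RabsE; apply/RltP; exact: Uf.
have [|g [gf gc _]] := @continuous_bounded_extension X R nX F clF f M' M'0 fwc.
  move=> x /fM /RleP; rewrite RabsE => /le_trans; apply.
  by rewrite le_max lexx.
exists g; split=> [x Fx|x e /RltP e0]; first by rewrite gf // inE.
have /cvgrPdist_lt /(_ e e0) := gc x.
rewrite nbhsE => -[U [oU Ux] Ug]; exists U; split => //; split => // y /Ug /=.
by rewrite distrC -RminusE -RabsE => /RltP.
Qed.
End Tietze.

(** * Complex numbers *)

Lemma Cnorm_Cmod (z : C) : Cnorm z = Cmod z.
Proof. unfold Cnorm, Cmod. f_equal. ring. Qed.

Lemma Cmod_minus_sym (z w : C) : Cmod (z - w) = Cmod (w - z).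
Proof. rewrite <- (Cmod_opp (z - w)). f_equal. ring. Qed.

Lemma Cmod_triangle_rev (z w : C) : Cmod z - Cmod w <= Cmod (z - w).
Proof.
  assert (H := Cmod_triangle (z - w) w).
  replace (z - w + w)%C with z in H by ring. lra.
Qed.

Lemma Cmod_le_sum (z : C) : Cmod z <= Rabs (fst z) + Rabs (snd z).
Proof.
  destruct z as [x y]; simpl.
  replace ((x, y) : C) with (RtoC x + Ci * RtoC y)%C
    by (unfold Ci, RtoC, Cplus, Cmult; simpl; f_equal; ring).
  eapply Rle_trans; [apply Cmod_triangle|].
  rewrite Cmod_mult, Cmod_Ci, !Cmod_R. lra.
Qed.

Lemma Cmod_fst (z : C) : Rabs (fst z) <= Cmod z.
Proof. eapply Rle_trans; [apply Rmax_l | apply Rmax_Cmod]. Qed.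

Lemma Cmod_snd (z : C) : Rabs (snd z) <= Cmod z.
Proof. eapply Rle_trans; [apply Rmax_r | apply Rmax_Cmod]. Qed.

Lemma Cmod_sq (z : C) : Cmod z * Cmod z = fst z * fst z + snd z * snd z.
Proof. assert (H := Cmod2_alt z). unfold Re, Im in H. lra. Qed.

Lemma Ceq_of_small (z w : C) : (forall eps, 0 < eps -> Cmod (z - w) <= eps) -> z = w.
Proof.
  intros H.
  assert (E : Cmod (z - w) = 0).
  { apply Rle_antisym; [|apply Cmod_ge_0].
    apply le_epsilon. intros eps He. rewrite Rplus_0_l. auto. }
  apply Cmod_eq_0 in E.
  replace z with (z - w + w)%C by ring. rewrite E. ring.
Qed.

(** * Square roots of complex numbers *)

(** Half-angle formulas for the root with nonnegative real part; on the negative real axis the root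
    with positive imaginary part is taken. *)
Definition csqrt (z : C) : C :=
  (sqrt ((Cmod z + fst z) / 2),
   (if Rle_dec 0 (snd z) then 1 else -1) * sqrt ((Cmod z - fst z) / 2)).

Lemma csqrt_sq (z : C) : (csqrt z * csqrt z)%C = z.
Proof.
  assert (Ha := Cmod_fst z). assert (Hs := Cmod_sq z).
  apply Rabs_le_between in Ha.
  assert (H1 : 0 <= (Cmod z + fst z) / 2) by lra.
  assert (H2 : 0 <= (Cmod z - fst z) / 2) by lra.
  assert (H3 : 2 * (sqrt ((Cmod z + fst z) / 2) * sqrt ((Cmod z - fst z) / 2)) = Rabs (snd z)).
  { rewrite <- sqrt_mult by assumption.
    replace ((Cmod z + fst z) / 2 * ((Cmod z - fst z) / 2)) with (Rsqr (snd z / 2)).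
    - rewrite sqrt_Rsqr_abs. unfold Rdiv. rewrite Rabs_mult, (Rabs_right (/ 2)) by lra. lra.
    - unfold Rsqr. nra. }
  apply injective_projections; unfold csqrt, Cmult; simpl.
  - assert (E1 := sqrt_sqrt _ H1). assert (E2 := sqrt_sqrt _ H2).
    destruct (Rle_dec 0 (snd z)); lra.
  - destruct (Rle_dec 0 (snd z)) as [Hy|Hy].
    + rewrite Rabs_right in H3 by lra. lra.
    + rewrite Rabs_left in H3 by lra. lra.
Qed.

Lemma csqrt_fst_ge (z : C) : / 4 <= fst z -> / 2 <= fst (csqrt z).
Proof.
  intros H. assert (E : fst (csqrt z * csqrt z)%C = fst z) by now rewrite csqrt_sq.
  assert (P : 0 <= fst (csqrt z)) by apply sqrt_pos.
  simpl in E. simpl in P. simpl. nra.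
Qed.

(** Here [u - v] is the product of the difference and the sum of the two roots; both roots have real
    part at least 1/2, so the sum has modulus at least 1. *)
Lemma csqrt_lipschitz (u v : C) : / 4 <= fst u -> / 4 <= fst v ->
  Cmod (csqrt u - csqrt v) <= Cmod (u - v).
Proof.
  intros Hu Hv. apply csqrt_fst_ge in Hu. apply csqrt_fst_ge in Hv.
  replace (u - v)%C with ((csqrt u - csqrt v) * (csqrt u + csqrt v))%C.
  - rewrite Cmod_mult.
    assert (H : 1 <= Cmod (csqrt u + csqrt v)).
    { eapply Rle_trans; [|apply Cmod_fst].
      rewrite Rabs_right; simpl in *; lra. }
    assert (P := Cmod_ge_0 (csqrt u - csqrt v)). nra.
  - rewrite <- (csqrt_sq u) at 3. rewrite <- (csqrt_sq v) at 3. ring.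
Qed.

(** * The circle as a quotient of the Cantor set *)

Definition b2R (b : bool) : R := if b then 1 else 0.

Definition scons (b : bool) (x : nat -> bool) : nat -> bool :=
  fun n => match n with O => b | S n => x n end.

Definition agree (n : nat) (s t : nat -> bool) : Prop :=
  forall k, (k < n)%nat -> s k = t k.

(** The angle as a fraction of a full turn. Dyadic fractions have two codes, which is harmless:
    digits are later recovered from moduli, not from angles. *)
Definition theta (x : nat -> bool) : R :=
  Series (fun n => b2R (x n) * (/ 2) ^ S n).

Lemma theta_ex (x : nat -> bool) : ex_series (fun n => b2R (x n) * (/ 2) ^ S n).
Proof.
  apply (ex_series_le (V := R_CompleteNormedModule) _ (fun n => (/ 2) ^ n)).
  - intros n. change (Rabs (b2R (x n) * (/ 2) ^ S n) <= (/ 2) ^ n).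
    assert (H : 0 < (/ 2) ^ n) by (apply pow_lt; lra).
    rewrite Rabs_right; destruct (x n); simpl; lra.
  - apply ex_series_geom. rewrite Rabs_right; lra.
Qed.

Lemma theta_step (x : nat -> bool) :
  theta x = (b2R (x O) + theta (fun n => x (S n))) / 2.
Proof.
  unfold theta. rewrite Series_incr_1 by apply theta_ex.
  rewrite (Series_ext (fun k => b2R (x (S k)) * (/ 2) ^ S (S k))
    (fun k => / 2 * (b2R (x (S k)) * (/ 2) ^ S k))) by (intros; simpl; ring).
  rewrite Series_scal_l. simpl. field.
Qed.

Lemma theta_scons (b : bool) (x : nat -> bool) :
  theta (scons b x) = (b2R b + theta x) / 2.
Proof. exact (theta_step (scons b x)). Qed.

Lemma theta_bounds (x : nat -> bool) : 0 <= theta x <= 1.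
Proof.
  split.
  - unfold theta.
    replace 0 with (Series (fun n => 0 * (/ 2) ^ n)) at 1 by (rewrite Series_scal_l; ring).
    apply Series_le; [|apply theta_ex].
    intros n. assert (H : 0 < (/ 2) ^ S n) by (apply pow_lt; lra).
    destruct (x n); simpl in *; lra.
  - replace 1 with (Series (fun n => / 2 * (/ 2) ^ n)).
    + apply Series_le.
      * intros n. assert (H : 0 < (/ 2) ^ n) by (apply pow_lt; lra).
        destruct (x n); simpl; lra.
      * apply (ex_series_scal_l (K := R_AbsRing) (/ 2) (fun n => (/ 2) ^ n)).
        apply ex_series_geom. rewrite Rabs_right; lra.
    + rewrite Series_scal_l, Series_geom by (rewrite Rabs_right; lra). field.
Qed.

Lemma theta_close (n : nat) : forall x y, agree n x y ->
  Rabs (theta x - theta y) <= (/ 2) ^ n.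
Proof.
  induction n as [|n IH]; intros x y H.
  - assert (Hx := theta_bounds x). assert (Hy := theta_bounds y).
    apply Rabs_le. simpl. lra.
  - rewrite (theta_step x), (theta_step y), (H O) by lia.
    replace (_ / 2 - _ / 2) with
      (/ 2 * (theta (fun n => x (S n)) - theta (fun n => y (S n)))) by field.
    rewrite Rabs_mult, Rabs_right by lra. simpl.
    apply Rmult_le_compat_l; [lra|]. apply IH. intros k Hk. apply H. lia.
Qed.

Definition circ (x : nat -> bool) : C :=
  (cos (2 * PI * theta x), sin (2 * PI * theta x)).

Lemma Cmod_circ (x : nat -> bool) : Cmod (circ x) = 1.
Proof.
  assert (H := sin2_cos2 (2 * PI * theta x)). unfold Rsqr in H.
  unfold Cmod, circ; cbn [fst snd].
  replace (_ + _) with 1 by lra. apply sqrt_1.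
Qed.

(** Prepending a digit halves the angle, after adding a full turn if the digit is [true]. So the two
    extensions of [x] code the two opposite square roots of [circ x], over which the maximum
    principle averages. *)
Lemma circ_false_sq (x : nat -> bool) :
  (circ (scons false x) * circ (scons false x))%C = circ x.
Proof.
  unfold circ. rewrite theta_scons. simpl.
  replace (2 * PI * ((0 + theta x) / 2)) with (PI * theta x) by field.
  replace (2 * PI * theta x) with (2 * (PI * theta x)) by ring.
  rewrite cos_2a, sin_2a. unfold Cmult; simpl. f_equal; ring.
Qed.

Lemma circ_true (x : nat -> bool) : circ (scons true x) = (- circ (scons false x))%C.
Proof.
  unfold circ. rewrite !theta_scons. simpl.
  replace (2 * PI * ((1 + theta x) / 2)) with (PI * theta x + PI) by field.
  replace (2 * PI * ((0 + theta x) / 2)) with (PI * theta x) by field.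
  rewrite neg_cos, neg_sin. reflexivity.
Qed.

(** * Uniformly continuous functions on the Cantor set and their square roots *)

Definition ucont (f : (nat -> bool) -> C) : Prop :=
  forall eps, 0 < eps ->
    exists n, forall s t, agree n s t -> Cmod (f s - f t) < eps.

Lemma sin_cos_lipschitz (a b : R) :
  Rabs (cos a - cos b) <= Rabs (a - b) /\ Rabs (sin a - sin b) <= Rabs (a - b).
Proof.
  split.
  - destruct (MVT_gen cos b a (fun x => - sin x)) as [c [_ E]].
    + intros x _. auto_derive; [trivial | ring].
    + intros x _. apply continuity_cos.
    + rewrite E, Rabs_mult, Rabs_Ropp.
      assert (H : Rabs (sin c) <= 1) by (apply Rabs_le; apply SIN_bound).
      assert (P := Rabs_pos (a - b)). nra.
  - destruct (MVT_gen sin b a cos) as [c [_ E]].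
    + intros x _. auto_derive; [trivial | ring].
    + intros x _. apply continuity_sin.
    + rewrite E, Rabs_mult.
      assert (H : Rabs (cos c) <= 1) by (apply Rabs_le; apply COS_bound).
      assert (P := Rabs_pos (a - b)). nra.
Qed.

Lemma pow_half_small (eps : R) : 0 < eps -> exists n, (/ 2) ^ n < eps.
Proof.
  intros He. destruct (pow_lt_1_zero (/ 2)) with (y := eps) as [n Hn]; trivial.
  - rewrite Rabs_right; lra.
  - exists n. specialize (Hn n (Nat.le_refl n)).
    rewrite Rabs_right in Hn; trivial. apply Rle_ge, pow_le. lra.
Qed.

Lemma ucont_circ : ucont circ.
Proof.
  intros eps He.
  assert (HP := PI_RGT_0).
  destruct (pow_half_small (eps / (4 * PI))) as [n Hn]; [apply Rdiv_lt_0_compat; lra|].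
  exists n. intros s t H. apply theta_close in H.
  eapply Rle_lt_trans; [apply Cmod_le_sum|]. unfold circ; simpl.
  destruct (sin_cos_lipschitz (2 * PI * theta s) (2 * PI * theta t)) as [Hc Hs].
  replace (2 * PI * theta s - 2 * PI * theta t) with (2 * PI * (theta s - theta t)) in Hc, Hs by ring.
  rewrite Rabs_mult, (Rabs_right (2 * PI)) in Hc, Hs by lra.
  assert (B : 4 * PI * Rabs (theta s - theta t) < eps).
  { replace eps with (4 * PI * (eps / (4 * PI))) by (field; lra).
    apply Rmult_lt_compat_l; lra. }
  unfold Rminus in *. lra.
Qed.

(** Total disconnectedness removes the winding obstruction. On each cylinder of length [n] a root is
    fixed at the representative [tr s], and [f s / f (tr s)] stays in the half plane where [csqrt]
    is Lipschitz. *)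
Lemma ucont_sqrt (f : (nat -> bool) -> C) (eta : R) :
  ucont f -> 0 < eta -> (forall s, eta <= Cmod (f s)) ->
  exists v, ucont v /\ forall s, (v s * v s)%C = f s.
Proof.
  intros Hf Heta Hlow.
  destruct (Hf (eta / 2)) as [n Hn]; [lra|].
  set (tr := fun (s : nat -> bool) k => if Nat.ltb k n then s k else false).
  assert (Hne : forall s, f s <> 0).
  { intros s E. specialize (Hlow s). rewrite E, Cmod_0 in Hlow. lra. }
  assert (Htr : forall s, agree n s (tr s)).
  { intros s k Hk. unfold tr. apply Nat.ltb_lt in Hk. now rewrite Hk. }
  assert (Hre : forall s, / 4 <= fst (f s / f (tr s))%C).
  { intros s. specialize (Hn _ _ (Htr s)).
    assert (E : (f s / f (tr s) = 1 + (f s - f (tr s)) / f (tr s))%C)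
      by (field; apply Hne).
    assert (B : Cmod ((f s - f (tr s)) / f (tr s)) < / 2).
    { rewrite Cmod_div by apply Hne. specialize (Hlow (tr s)).
      apply Rmult_lt_reg_r with (Cmod (f (tr s))); [lra|].
      unfold Rdiv. rewrite Rmult_assoc, Rinv_l by lra. lra. }
    assert (B' := Cmod_fst ((f s - f (tr s)) / f (tr s))).
    rewrite E. cbn [fst Cplus RtoC].
    assert (B2 := Rle_lt_trans _ _ _ B' B). apply Rabs_def2 in B2. lra. }
  exists (fun s => csqrt (f (tr s)) * csqrt (f s / f (tr s)))%C. split.
  - intros eps He.
    assert (Hq : 0 < sqrt eta) by now apply sqrt_lt_R0.
    destruct (Hf (eps * sqrt eta)) as [m Hm]; [now apply Rmult_lt_0_compat|].
    (* [n] puts [s] and [t] into one cylinder, hence over the same root [csqrt g]; [m] makes [f s]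
       and [f t] close enough to absorb the division by [Cmod (csqrt g)], which is at least
       [sqrt eta]. *)
    exists (max n m). intros s t Hst.
    assert (Et : tr t = tr s).
    { apply functional_extensionality. intros k. unfold tr.
      destruct (Nat.ltb_spec k n); trivial. symmetry. apply Hst. lia. }
    assert (Hs := Hre s). assert (Ht := Hre t). rewrite Et in Ht |- *.
    set (g := f (tr s)) in *.
    replace (_ - _)%C with (csqrt g * (csqrt (f s / g) - csqrt (f t / g)))%C by ring.
    rewrite Cmod_mult.
    assert (Hl := csqrt_lipschitz _ _ Hs Ht).
    replace (f s / g - f t / g)%C with ((f s - f t) / g)%C in Hl
      by (field; apply Hne).
    rewrite Cmod_div in Hl by apply Hne.
    assert (Hg : Cmod g = Cmod (csqrt g) * Cmod (csqrt g))
      by (rewrite <- Cmod_mult, csqrt_sq; reflexivity).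
    assert (Hgl : eta <= Cmod g) by apply Hlow.
    set (q := Cmod (csqrt g)) in *.
    assert (Hqq : sqrt eta <= q).
    { rewrite <- (sqrt_square q) by apply Cmod_ge_0. apply sqrt_le_1_alt. lra. }
    assert (Hd : Cmod (f s - f t) < eps * sqrt eta)
      by (apply Hm; intros k Hk; apply Hst; lia).
    apply Rle_lt_trans with (q * (Cmod (f s - f t) / Cmod g)).
    + apply Rmult_le_compat_l; [lra | exact Hl].
    + rewrite Hg. replace (q * _) with (Cmod (f s - f t) / q) by (field; lra).
      apply Rmult_lt_reg_r with q; [lra|].
      unfold Rdiv. rewrite Rmult_assoc, Rinv_l by lra. nra.
  - intros s.
    replace (_ * _)%C with ((csqrt (f (tr s)) * csqrt (f (tr s))) *
      (csqrt (f s / f (tr s)) * csqrt (f s / f (tr s))))%C by ring.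
    rewrite !csqrt_sq. field. apply Hne.
Qed.

(** * The maximum principle for polynomials *)

Fixpoint horner (cs : list C) (t : C) : C :=
  match cs with nil => 0 | c :: cs => c + t * horner cs t end.

Definition is_poly (h : C -> C) : Prop := exists cs, forall t, h t = horner cs t.

(** Coefficients of even degree, that is, of the average of the values at [t] and [- t] as a
    polynomial in [t^2]. *)
Fixpoint evens (cs : list C) : list C :=
  match cs with a :: _ :: cs => a :: evens cs | _ => cs end.

Lemma horner_evens (n : nat) : forall cs t, (length cs <= n)%nat ->
  (horner cs t + horner cs (- t) = 2 * horner (evens cs) (t * t))%C.
Proof.
  induction n as [n IH] using lt_wf_ind. intros [|a [|b cs]] t Hn; cbn [horner evens].
  - ring.
  - ring.
  - simpl in Hn.
    replace (2 * (a + t * t * horner (evens cs) (t * t)))%C with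
      (2 * a + t * t * (2 * horner (evens cs) (t * t)))%C by ring.
    rewrite <- (IH (length cs)) by lia. ring.
Qed.

Lemma length_evens (n : nat) : forall cs, (length cs <= n)%nat ->
  (length (evens cs) <= length cs)%nat.
Proof.
  induction n as [n IH] using lt_wf_ind. intros [|a [|b cs]] Hn; simpl in *; try lia.
  specialize (IH (length cs) ltac:(lia) cs (Nat.le_refl _)). lia.
Qed.

(** In place of an integral: averaging over the two square roots of a point of the circle passes
    from [cs] to [evens cs], which keeps the value at 0 and the bound on the circle but shortens the
    list. The process ends with a constant. *)
Lemma horner_max (M : R) (n : nat) : forall cs, (length cs <= n)%nat ->
  (forall x, Cmod (horner cs (circ x)) <= M) -> Cmod (horner cs 0) <= M.
Proof.
  induction n as [n IH] using lt_wf_ind. intros [|a [|b cs]] Hn H.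
  - exact (H (fun _ => true)).
  - specialize (H (fun _ => true)). cbn [horner] in *.
    rewrite Cmult_0_r in *. exact H.
  - replace (horner (a :: b :: cs) 0) with (horner (evens (a :: b :: cs)) 0)
      by (cbn [horner evens]; ring).
    assert (L := length_evens (length cs) cs (Nat.le_refl _)).
    apply (IH (length (evens (a :: b :: cs)))); [simpl in *; lia | lia |].
    intros x.
    assert (E := horner_evens _ (a :: b :: cs) (circ (scons false x)) (Nat.le_refl _)).
    rewrite circ_false_sq, <- circ_true in E.
    set (y := horner (evens (a :: b :: cs)) (circ x)) in *.
    assert (H1 := H (scons false x)). assert (H2 := H (scons true x)).
    assert (H3 : Cmod (2 * y) <= M + M).
    { rewrite <- E. eapply Rle_trans; [apply Cmod_triangle | lra]. }
    rewrite Cmod_mult, Cmod_R, Rabs_right in H3 by lra. lra.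
Qed.

Lemma is_poly_const (c : C) : is_poly (fun _ => c).
Proof. exists (c :: nil). intros t. cbn [horner]. ring. Qed.

Lemma is_poly_shift (h : C -> C) : is_poly h -> is_poly (fun t => t * h t)%C.
Proof. intros [cs H]. exists (RtoC 0 :: cs). intros t. cbn [horner]. rewrite H. ring. Qed.

Lemma is_poly_plus (g h : C -> C) :
  is_poly g -> is_poly h -> is_poly (fun t => g t + h t)%C.
Proof.
  intros [cs Hg] [ds Hh].
  assert (H : exists es, forall t, (horner cs t + horner ds t)%C = horner es t).
  { clear Hg Hh g h. revert ds. induction cs as [|c cs IH]; intros ds.
    - exists ds. intros t. cbn [horner]. ring.
    - destruct ds as [|d ds].
      + exists (c :: cs). intros t. cbn [horner]. ring.
      + destruct (IH ds) as [es E]. exists (c + d :: es)%C. intros t. cbn [horner].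
        rewrite <- E. ring. }
  destruct H as [es E]. exists es. intros t. now rewrite Hg, Hh.
Qed.

Lemma is_poly_scal (c : C) (h : C -> C) : is_poly h -> is_poly (fun t => c * h t)%C.
Proof.
  intros [cs H]. exists (map (Cmult c) cs). intros t. rewrite H. clear H.
  induction cs as [|d cs IH]; cbn [horner map]; [ring|]. rewrite <- IH. ring.
Qed.

Lemma is_poly_mult (g h : C -> C) :
  is_poly g -> is_poly h -> is_poly (fun t => g t * h t)%C.
Proof.
  intros [cs Hg] Hh.
  assert (H : is_poly (fun t => horner cs t * h t)%C).
  { clear Hg g. induction cs as [|c cs IH].
    - exists nil. intros t. cbn [horner]. ring.
    - destruct (is_poly_plus _ _ (is_poly_scal c _ Hh) (is_poly_shift _ IH)) as [es E].
      exists es. intros t. rewrite <- E. cbn [horner]. ring. }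
  destruct H as [es E]. exists es. intros t. rewrite Hg. apply E.
Qed.

Lemma is_poly_max (h : C -> C) (r : C) (M : R) : is_poly h ->
  (forall x, Cmod (h (r * circ x)%C) <= M) -> Cmod (h 0) <= M.
Proof.
  intros Hp H.
  assert (Q : is_poly (fun t => h (r * t))%C).
  { destruct Hp as [cs E].
    assert (Q : is_poly (fun t => horner cs (r * t))%C).
    { clear. induction cs as [|c cs IH]; cbn [horner].
      - apply is_poly_const.
      - apply is_poly_plus; [apply is_poly_const|].
        apply is_poly_mult; [|exact IH].
        apply is_poly_scal. exists (RtoC 0 :: RtoC 1 :: nil). intros t. cbn [horner]. ring. }
    destruct Q as [ds D]. exists ds. intros t. rewrite E. apply D. }
  destruct Q as [ds D].
  replace (RtoC 0) with (r * 0)%C by ring. rewrite D.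
  apply (horner_max M (length ds)); trivial. intros x. rewrite <- D. apply H.
Qed.

(** * A dense sequence off the circles of radii 1 and 2 *)

(** An integer is coded as a difference of two naturals. The factor [sqrt 3] serves to keep the
    lattice points off the circles of radii 1 and 2. *)
Definition lattice_coord (n p : nat) : R :=
  let (p1, p2) := of_nat p in sqrt 3 * ((INR p1 - INR p2) / 2 ^ n).

Definition branch_point (l : nat) : C :=
  let (n, m) := of_nat l in let (p, q) := of_nat m in
  (lattice_coord n p, lattice_coord n q).

(* [|a|^2 = 3 k / 4^n], which is never a power of 4. *)
Lemma branch_point_mod_sq (l : nat) : exists (n : nat) (k : Z),
  (Cmod (branch_point l) * Cmod (branch_point l)) * 4 ^ n = 3 * IZR k.
Proof.
  unfold branch_point. destruct (of_nat l) as [n m]. destruct (of_nat m) as [p q].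
  rewrite Cmod_sq. unfold lattice_coord; simpl.
  destruct (of_nat p) as [p1 p2]. destruct (of_nat q) as [q1 q2].
  set (a := (Z.of_nat p1 - Z.of_nat p2)%Z). set (b := (Z.of_nat q1 - Z.of_nat q2)%Z).
  exists n, (a * a + b * b)%Z.
  rewrite plus_IZR, !mult_IZR. unfold a, b. rewrite !minus_IZR, <- !INR_IZR_INZ.
  assert (H3 := sqrt_sqrt 3 ltac:(lra)).
  assert (Hn : 2 ^ n <> 0) by (apply pow_nonzero; lra).
  replace (4 ^ n) with (2 ^ n * 2 ^ n) by (rewrite <- Rpow_mult_distr; f_equal; lra).
  replace (_ * (2 ^ n * 2 ^ n)) with
    (sqrt 3 * sqrt 3 * ((INR p1 - INR p2) * (INR p1 - INR p2)
       + (INR q1 - INR q2) * (INR q1 - INR q2))) by (field; assumption).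
  rewrite H3. reflexivity.
Qed.

Lemma pow4_mod3 (n : nat) (k : Z) : 4 ^ n <> 3 * IZR k.
Proof.
  intros H.
  assert (E : exists j, (4 ^ Z.of_nat n = 3 * j + 1)%Z).
  { clear H. induction n as [|n [j IH]].
    - exists 0%Z. reflexivity.
    - exists (4 * j + 1)%Z. rewrite Nat2Z.inj_succ, Z.pow_succ_r by lia. lia. }
  destruct E as [j E].
  rewrite pow_IZR, <- mult_IZR in H. apply eq_IZR in H. lia.
Qed.

Lemma branch_point_mod_1 (l : nat) : Cmod (branch_point l) <> 1.
Proof.
  intros E. destruct (branch_point_mod_sq l) as [n [k H]]. rewrite E in H.
  apply (pow4_mod3 n k). lra.
Qed.

Lemma branch_point_mod_2 (l : nat) : Cmod (branch_point l) <> 2.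
Proof.
  intros E. destruct (branch_point_mod_sq l) as [n [k H]]. rewrite E in H.
  apply (pow4_mod3 (S n) k). simpl. lra.
Qed.

Lemma lattice_coord_approx (n : nat) (x : R) :
  exists p, Rabs (lattice_coord n p - x) <= sqrt 3 * (/ 2) ^ n.
Proof.
  assert (Hn : 0 < (/ 2) ^ n) by (apply pow_lt; lra).
  assert (H3 : 0 < sqrt 3) by (apply sqrt_lt_R0; lra).
  set (d := sqrt 3 * (/ 2) ^ n). assert (Hd : 0 < d) by now apply Rmult_lt_0_compat.
  destruct (archimed (x / d)) as [A1 A2]. set (z := up (x / d)) in *.
  (* Positive and negative part of [z]; [Z.to_nat] sends negative integers to 0. *)
  exists (to_nat (Z.to_nat z, Z.to_nat (- z))).
  unfold lattice_coord. rewrite cancel_of_to.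
  replace (INR (Z.to_nat z) - INR (Z.to_nat (- z))) with (IZR z).
  - replace (sqrt 3 * (IZR z / 2 ^ n)) with (d * IZR z).
    + replace (d * IZR z - x) with (d * (IZR z - x / d)) by (field; lra).
      rewrite Rabs_mult, !Rabs_right by lra. nra.
    + unfold d. rewrite pow_inv. field. apply pow_nonzero; lra.
  - rewrite !INR_IZR_INZ, <- minus_IZR. f_equal. lia.
Qed.

Lemma branch_point_dense (c : C) (eps : R) : 0 < eps ->
  exists l, Cmod (branch_point l - c) < eps.
Proof.
  intros He. assert (H3 : 0 < sqrt 3) by (apply sqrt_lt_R0; lra).
  destruct (pow_half_small (eps / (4 * sqrt 3))) as [n Hn];
    [apply Rdiv_lt_0_compat; lra|].
  destruct (lattice_coord_approx n (fst c)) as [p Hp].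
  destruct (lattice_coord_approx n (snd c)) as [q Hq].
  exists (to_nat (n, to_nat (p, q))). unfold branch_point. rewrite !cancel_of_to.
  eapply Rle_lt_trans; [apply Cmod_le_sum|]. simpl. fold (lattice_coord n p - fst c).
  fold (lattice_coord n q - snd c).
  assert (B : sqrt 3 * (/ 2) ^ n < eps / 4).
  { replace (eps / 4) with (sqrt 3 * (eps / (4 * sqrt 3))) by (field; lra).
    now apply Rmult_lt_compat_l. }
  unfold Rminus in *. lra.
Qed.

(** * The generators *)

Definition row (k : nat) (y : nat -> bool) : nat -> bool := fun j => y (to_nat (k, j)).

(** The shift of index matters: circle [k + 1] is governed by digit [k], which lies in a row [<= k].
    Hence overwriting row [n] changes no radius of index [<= n]. *)
Definition radius (k : nat) (y : nat -> bool) : R :=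
  match k with O => 1 | S k => 1 + b2R (y k) end.

Definition gz (k : nat) (y : nat -> bool) : C := (RtoC (radius k y) * circ (row k y))%C.

Lemma radius_cases (k : nat) (y : nat -> bool) : radius k y = 1 \/ radius k y = 2.
Proof. destruct k as [|k]; simpl; [|destruct (y k); simpl]; lra. Qed.

Lemma Cmod_gz (k : nat) (y : nat -> bool) : Cmod (gz k y) = radius k y.
Proof.
  unfold gz. rewrite Cmod_mult, Cmod_circ, Cmod_R.
  destruct (radius_cases k y) as [-> | ->]; rewrite Rabs_right; lra.
Qed.

Lemma ucont_gz (k : nat) : ucont (gz k).
Proof.
  intros eps He. destruct (ucont_circ (eps / 2)) as [n Hn]; [lra|].
  assert (HN : exists N, forall j, (j < n)%nat -> (to_nat (k, j) < N)%nat).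
  { clear Hn. induction n as [|n [N IH]].
    - exists O. intros j Hj. lia.
    - exists (max N (S (to_nat (k, n)))). intros j Hj.
      destruct (Nat.eq_dec j n) as [->|]; [lia|]. specialize (IH j). lia. }
  (* [N] secures the first [n] digits of row [k], and [k] secures the digit [k - 1] that sets the
     radius. *)
  destruct HN as [N HN]. exists (max N k). intros y y' H.
  assert (Er : radius k y' = radius k y).
  { destruct k as [|k]; simpl; trivial. rewrite (H k); trivial. lia. }
  unfold gz. rewrite Er.
  replace (_ - _)%C with (radius k y * (circ (row k y) - circ (row k y')))%C by ring.
  assert (B : Cmod (circ (row k y) - circ (row k y')) < eps / 2).
  { apply Hn. intros j Hj. apply H. specialize (HN j Hj). lia. }
  assert (P := Cmod_ge_0 (circ (row k y) - circ (row k y'))).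
  rewrite Cmod_mult, Cmod_R.
  destruct (radius_cases k y) as [-> | ->]; rewrite Rabs_right; lra.
Qed.

(** The modulus of [gz k y] is 1 or 2, whereas that of a branch point is neither; the gap is
    therefore uniform in [y]. *)
Lemma gz_branch_gap (k l : nat) : exists eta, 0 < eta /\
  forall y, eta <= Cmod (gz k y - branch_point l).
Proof.
  set (a := branch_point l).
  exists (Rmin (Rabs (1 - Cmod a)) (Rabs (2 - Cmod a))). split.
  - assert (H1 := branch_point_mod_1 l). assert (H2 := branch_point_mod_2 l). fold a in H1, H2.
    apply Rmin_glb_lt; apply Rabs_pos_lt; lra.
  - intros y. assert (H1 := Cmod_triangle_rev (gz k y) a).
    assert (H2 := Cmod_triangle_rev a (gz k y)). rewrite (Cmod_minus_sym a) in H2.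
    rewrite Cmod_gz in *.
    destruct (radius_cases k y) as [E | E]; rewrite E in *.
    + eapply Rle_trans; [apply Rmin_l|]. apply Rabs_le. lra.
    + eapply Rle_trans; [apply Rmin_r|]. apply Rabs_le. lra.
Qed.

(** The index [m] of a square root codes a pair: which [z_k] is involved, and which branch point is
    subtracted from it. Every pair occurs. *)
Definition base (m : nat) : nat := fst (of_nat m).
Definition center (m : nat) : C := branch_point (snd (of_nat m)).

Lemma root_exists (m : nat) : exists v, ucont v /\
  forall y, (v y * v y)%C = (gz (base m) y - center m)%C.
Proof.
  destruct (gz_branch_gap (base m) (snd (of_nat m))) as [eta [He H]].
  apply ucont_sqrt with eta; trivial.
  intros eps Heps. destruct (ucont_gz (base m) eps Heps) as [n Hn]. exists n.
  intros s t Hst. specialize (Hn s t Hst).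
  replace (_ - _)%C with (gz (base m) s - gz (base m) t)%C by ring. exact Hn.
Qed.

Definition root (m : nat) : (nat -> bool) -> C :=
  proj1_sig (constructive_indefinite_description _ (root_exists m)).

Lemma ucont_root (m : nat) : ucont (root m).
Proof. unfold root. now destruct constructive_indefinite_description as [v []]. Qed.

Lemma root_sq (m : nat) (y : nat -> bool) :
  (root m y * root m y)%C = (gz (base m) y - center m)%C.
Proof. unfold root. now destruct constructive_indefinite_description as [v []]; simpl. Qed.

Lemma root_neq_0 (m : nat) (y : nat -> bool) : root m y <> 0.
Proof.
  intros E. assert (H := root_sq m y). rewrite E, Cmult_0_r in H.
  destruct (gz_branch_gap (base m) (snd (of_nat m))) as [eta [He Hg]].
  specialize (Hg y). unfold center in H. rewrite <- H, Cmod_0 in Hg. lra.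
Qed.

(** One binary sequence carries both kinds of data: the array of digits at the even positions, and
    at position [2 * m + 1] the sign of the [m]-th root. *)
Definition even_part (s : nat -> bool) : nat -> bool := fun n => s (2 * n)%nat.

Definition sgn (b : bool) : R := if b then 1 else -1.

Definition gw (m : nat) (s : nat -> bool) : C :=
  (RtoC (sgn (s (2 * m + 1)%nat)) * root m (even_part s))%C.

Lemma gw_sq (m : nat) (s : nat -> bool) :
  (gw m s * gw m s)%C = (gz (base m) (even_part s) - center m)%C.
Proof.
  rewrite <- root_sq. unfold gw.
  replace (_ * _)%C with (RtoC (sgn (s (2 * m + 1)%nat)) * RtoC (sgn (s (2 * m + 1)%nat)) *
    (root m (even_part s) * root m (even_part s)))%C by ring.
  rewrite <- RtoC_mult. replace (_ * _)%R with 1; [ring|].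
  destruct (s (2 * m + 1)%nat); simpl; ring.
Qed.

Lemma ucont_even (f : (nat -> bool) -> C) : ucont f -> ucont (fun s => f (even_part s)).
Proof.
  intros Hf eps He. destruct (Hf eps He) as [n Hn]. exists (2 * n)%nat.
  intros s t H. apply Hn. intros k Hk. apply H. lia.
Qed.

Lemma ucont_gw (m : nat) : ucont (gw m).
Proof.
  intros eps He. destruct (ucont_even _ (ucont_root m) eps He) as [n Hn].
  exists (max n (2 * m + 2)). intros s t H. unfold gw.
  rewrite (H (2 * m + 1)%nat) by lia.
  replace (_ - _)%C with (RtoC (sgn (t (2 * m + 1)%nat)) *
    (root m (even_part s) - root m (even_part t)))%C by ring.
  rewrite Cmod_mult, Cmod_R.
  replace (Rabs _) with 1.
  - rewrite Rmult_1_l. apply Hn. intros k Hk. apply H. lia.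
  - destruct (t (2 * m + 1)%nat); simpl; [rewrite Rabs_right | rewrite Rabs_left]; lra.
Qed.

(* The moduli of the [gz] recover the even digits, the signs of the [gw] the odd ones. *)
Lemma generators_separate (s t : nat -> bool) :
  (forall k, gz k (even_part s) = gz k (even_part t)) ->
  (forall m, gw m s = gw m t) -> s = t.
Proof.
  intros Hz Hw.
  assert (He : even_part s = even_part t).
  { apply functional_extensionality. intros j.
    assert (E := f_equal Cmod (Hz (S j))). rewrite !Cmod_gz in E. simpl in E.
    destruct (even_part s j), (even_part t j); simpl in E; trivial; lra. }
  apply functional_extensionality. intros n.
  destruct (Nat.Even_or_Odd n) as [[k ->]|[k ->]].
  - exact (f_equal (fun y => y k) He).
  - specialize (Hw k). unfold gw in Hw. rewrite He in Hw.
    assert (E : RtoC (sgn (s (2 * k + 1)%nat)) = RtoC (sgn (t (2 * k + 1)%nat))).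
    { assert (N := root_neq_0 k (even_part t)).
      replace (RtoC (sgn (s (2 * k + 1)%nat))) with
        (RtoC (sgn (s (2 * k + 1)%nat)) * root k (even_part t) / root k (even_part t))%C
        by (field; exact N).
      rewrite Hw. field. exact N. }
    apply RtoC_inj in E.
    destruct (s (2 * k + 1)%nat), (t (2 * k + 1)%nat); simpl in E; trivial; lra.
Qed.

(** * Polynomials in the generators *)

(** Polynomials are kept as syntax because the same expression is evaluated on the Cantor set, at
    the origin, and in functions on all of [K]. *)
Inductive expr : Type :=
| EC (c : C)
| EZ (k : nat)
| EW (m : nat)
| EAdd (p q : expr)
| EMul (p q : expr).

Fixpoint eval (z w : nat -> C) (p : expr) : C :=
  match p with
  | EC c => c
  | EZ k => z k
  | EW m => w m
  | EAdd p q => eval z w p + eval z w q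
  | EMul p q => eval z w p * eval z w q
  end.

Fixpoint uses (n m : nat) (p : expr) : Prop :=
  match p with
  | EC _ => True
  | EZ k => (k < n)%nat
  | EW j => (j < m)%nat
  | EAdd p q | EMul p q => uses n m p /\ uses n m q
  end.

Definition ev (s : nat -> bool) : expr -> C :=
  eval (fun k => gz k (even_part s)) (fun m => gw m s).

(** A point over the origin: the relation [w_m^2 = z - center m] persists at [z = 0], with one root
    fixed for each [m]. *)
Definition ev0 : expr -> C := eval (fun _ => 0) (fun m => csqrt (- center m)).

Definition ESub (p q : expr) : expr := EAdd p (EMul (EC (-1)) q).

Lemma eval_ESub (z w : nat -> C) (p q : expr) :
  eval z w (ESub p q) = (eval z w p - eval z w q)%C.
Proof. simpl. ring. Qed.

Lemma uses_mono (n m n' m' : nat) (p : expr) : (n <= n')%nat -> (m <= m')%nat ->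
  uses n m p -> uses n' m' p.
Proof. intros Hn Hm. induction p; simpl; intuition lia. Qed.

Lemma uses_exists (p : expr) : exists n m, uses n m p.
Proof.
  induction p as [c|k|m|p [n1 [m1 H1]] q [n2 [m2 H2]]|p [n1 [m1 H1]] q [n2 [m2 H2]]].
  - exists O, O. exact I.
  - exists (S k), O. simpl. lia.
  - exists O, (S m). simpl. lia.
  - exists (max n1 n2), (max m1 m2). split.
    + apply (uses_mono n1 m1); trivial; lia.
    + apply (uses_mono n2 m2); trivial; lia.
  - exists (max n1 n2), (max m1 m2). split.
    + apply (uses_mono n1 m1); trivial; lia.
    + apply (uses_mono n2 m2); trivial; lia.
Qed.

Lemma eval_ext (n m : nat) (z w z' w' : nat -> C) (p : expr) : uses n m p ->
  (forall k, (k < n)%nat -> z k = z' k) -> (forall j, (j < m)%nat -> w j = w' j) ->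
  eval z w p = eval z' w' p.
Proof.
  intros Hu Hz Hw. induction p; simpl in *; auto.
  - destruct Hu. now rewrite IHp1, IHp2.
  - destruct Hu. now rewrite IHp1, IHp2.
Qed.

Lemma ev_bounded (p : expr) : exists M, 0 <= M /\ forall s, Cmod (ev s p) <= M.
Proof.
  induction p as [c|k|m|p [M [HM Hp]] q [N [HN Hq]]|p [M [HM Hp]] q [N [HN Hq]]].
  - exists (Cmod c). split; [apply Cmod_ge_0|]. intros s. apply Rle_refl.
  - exists 2. split; [lra|]. intros s. unfold ev, eval. rewrite Cmod_gz.
    destruct (radius_cases k (even_part s)); lra.
  - exists (3 + Cmod (center m)). assert (P := Cmod_ge_0 (center m)). split; [lra|].
    intros s. unfold ev, eval.
    assert (E := f_equal Cmod (gw_sq m s)). rewrite Cmod_mult in E.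
    assert (T := Cmod_triangle (gz (base m) (even_part s)) (- center m)).
    rewrite Cmod_opp, Cmod_gz in T. fold (Cminus (gz (base m) (even_part s)) (center m)) in T.
    assert (Q := Cmod_ge_0 (gw m s)).
    destruct (radius_cases (base m) (even_part s)) as [R | R]; rewrite R in T; nra.
  - exists (M + N). split; [lra|]. intros s. unfold ev; simpl.
    eapply Rle_trans; [apply Cmod_triangle|].
    apply Rplus_le_compat; [apply Hp | apply Hq].
  - exists (M * N). split; [nra|]. intros s. unfold ev; simpl.
    rewrite Cmod_mult. apply Rmult_le_compat; [apply Cmod_ge_0 .. | apply Hp | apply Hq].
Qed.

(** * Filling in the circles one by one *)

Definition upd (z : nat -> C) (n : nat) (t : C) : nat -> C :=
  fun k => if Nat.eqb k n then t else z k.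

Fixpoint zero_at (n : nat) (p : expr) : expr :=
  match p with
  | EZ k => if Nat.eqb k n then EC 0 else EZ k
  | EAdd p q => EAdd (zero_at n p) (zero_at n q)
  | EMul p q => EMul (zero_at n p) (zero_at n q)
  | _ => p
  end.

Lemma eval_zero_at (z w : nat -> C) (n : nat) (p : expr) :
  eval z w (zero_at n p) = eval (upd z n 0) w p.
Proof.
  induction p; simpl; trivial; try congruence.
  unfold upd. now destruct (Nat.eqb k n).
Qed.

Lemma uses_zero_at (n m : nat) (p : expr) : uses (S n) m p -> uses n m (zero_at n p).
Proof.
  induction p; simpl; trivial; try tauto.
  destruct (Nat.eqb_spec k n); simpl; [trivial | lia].
Qed.

Lemma eval_is_poly (z w : nat -> C) (n : nat) (p : expr) :
  is_poly (fun t => eval (upd z n t) w p).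
Proof.
  induction p; simpl.
  - apply is_poly_const.
  - unfold upd. destruct (Nat.eqb k n); [|apply is_poly_const].
    exists (RtoC 0 :: RtoC 1 :: nil). intros t. cbn [horner]. ring.
  - apply is_poly_const.
  - now apply is_poly_plus.
  - now apply is_poly_mult.
Qed.

Definition set_row (n : nat) (x y : nat -> bool) : nat -> bool :=
  fun i => let (k, j) := of_nat i in if Nat.eqb k n then x j else y i.

Lemma radius_set_row (n k : nat) (x y : nat -> bool) : (k <= n)%nat ->
  radius k (set_row n x y) = radius k y.
Proof.
  intros Hk. destruct k as [|k]; simpl; trivial. unfold set_row.
  destruct (of_nat k) as [i j] eqn:E.
  assert (H := to_nat_non_decreasing i j). rewrite <- E, cancel_to_of in H.
  destruct (Nat.eqb_spec i n); trivial. lia.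
Qed.

Lemma gz_set_row_lt (n k : nat) (x y : nat -> bool) : (k < n)%nat ->
  gz k (set_row n x y) = gz k y.
Proof.
  intros Hk. unfold gz. rewrite radius_set_row by lia. f_equal. f_equal.
  apply functional_extensionality. intros j. unfold row, set_row.
  rewrite cancel_of_to. destruct (Nat.eqb_spec k n); trivial. lia.
Qed.

Lemma gz_set_row_eq (n : nat) (x y : nat -> bool) :
  gz n (set_row n x y) = (RtoC (radius n y) * circ x)%C.
Proof.
  unfold gz. rewrite radius_set_row by lia. f_equal. f_equal.
  apply functional_extensionality. intros j. unfold row, set_row.
  now rewrite cancel_of_to, Nat.eqb_refl.
Qed.

(* Iterated maximum principle: the circle carrying [z_n] is filled in while the rows
   below [n], hence [z_0, ..., z_(n-1)] and the radius of that circle, stay fixed. *)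
Lemma ev0_le_no_roots (M : R) (w : nat -> C) (n : nat) : forall p, uses n 0 p ->
  (forall y, Cmod (eval (fun k => gz k y) w p) <= M) ->
  Cmod (eval (fun _ => RtoC 0) w p) <= M.
Proof.
  induction n as [|n IH]; intros p Hu H.
  - rewrite (eval_ext 0 0 _ w (fun k => gz k (fun _ => true)) w) by (trivial; intros; lia).
    apply H.
  - replace (eval (fun _ => RtoC 0) w p) with (eval (fun _ => RtoC 0) w (zero_at n p)).
    + apply IH; [now apply uses_zero_at|]. intros y. rewrite eval_zero_at.
      apply (is_poly_max (fun t => eval (upd (fun k => gz k y) n t) w p) (radius n y));
        [apply eval_is_poly|].
      intros x.
      (* Every point of the circle to be filled in is attained on the Cantor set: row [n] of [y] is
         overwritten by [x]. *)
      rewrite (eval_ext (S n) 0 _ w (fun k => gz k (set_row n x y)) w); trivial.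
      intros k Hk. unfold upd. destruct (Nat.eqb_spec k n) as [->|].
      * symmetry. apply gz_set_row_eq.
      * symmetry. apply gz_set_row_lt. lia.
    + rewrite eval_zero_at. apply (eval_ext (S n) 0); trivial.
      intros k _. unfold upd. now destruct (Nat.eqb k n).
Qed.

(** * Conjugation and elimination of the square roots *)

Definition flip (m : nat) (s : nat -> bool) : nat -> bool :=
  fun j => if Nat.eqb j (2 * m + 1) then negb (s j) else s j.

Lemma even_part_flip (m : nat) (s : nat -> bool) : even_part (flip m s) = even_part s.
Proof.
  apply functional_extensionality. intros n. unfold even_part, flip.
  destruct (Nat.eqb_spec (2 * n) (2 * m + 1)); trivial. lia.
Qed.

Lemma gw_flip_eq (m : nat) (s : nat -> bool) : gw m (flip m s) = (- gw m s)%C.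
Proof.
  unfold gw. rewrite even_part_flip. unfold flip. rewrite Nat.eqb_refl.
  replace (sgn (negb _)) with (- sgn (s (2 * m + 1)%nat))
    by (destruct (s (2 * m + 1)%nat); simpl; ring).
  rewrite RtoC_opp. ring.
Qed.

Lemma gw_flip_neq (m j : nat) (s : nat -> bool) : j <> m -> gw j (flip m s) = gw j s.
Proof.
  intros Hj. unfold gw. rewrite even_part_flip. unfold flip.
  destruct (Nat.eqb_spec (2 * j + 1) (2 * m + 1)); trivial. lia.
Qed.

(** Reduction modulo the quadratic relation for [w m]: in a product, the square of [w m] is replaced
    by [z (base m) - center m]. The bound [base m < N] makes this variable admissible. *)
Lemma expr_split (N m : nat) (p : expr) : (base m < N)%nat -> uses N (S m) p ->
  exists a b, uses N m a /\ uses N m b /\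
    forall z w : nat -> C, (w m * w m = z (base m) - center m)%C ->
      eval z w p = (eval z w a + eval z w b * w m)%C.
Proof.
  intros HN. induction p as [c|k|j|p IHp q IHq|p IHp q IHq]; intros Hu; simpl in Hu.
  - exists (EC c), (EC 0). simpl. repeat split; trivial. intros. ring.
  - exists (EZ k), (EC 0). simpl. repeat split; trivial. intros. ring.
  - destruct (Nat.eq_dec j m) as [->|Hj].
    + exists (EC 0), (EC 1). simpl. repeat split; trivial. intros. ring.
    + exists (EW j), (EC 0). simpl. repeat split; trivial; [lia|]. intros. ring.
  - destruct Hu as [Hp Hq].
    destruct (IHp Hp) as [a [b [Ha [Hb E]]]]. destruct (IHq Hq) as [c [d [Hc [Hd F]]]].
    exists (EAdd a c), (EAdd b d). simpl. repeat split; trivial.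
    intros z w H. rewrite E, F by assumption. ring.
  - destruct Hu as [Hp Hq].
    destruct (IHp Hp) as [a [b [Ha [Hb E]]]]. destruct (IHq Hq) as [c [d [Hc [Hd F]]]].
    exists (EAdd (EMul a c) (EMul (EMul b d) (EAdd (EZ (base m)) (EC (- center m))))),
      (EAdd (EMul a d) (EMul b c)). simpl. repeat split; trivial.
    intros z w H. rewrite E, F by assumption.
    replace (z (base m) + - center m)%C with (w m * w m)%C by (rewrite H; ring). ring.
Qed.

Fixpoint EPow (p : expr) (n : nat) : expr :=
  match n with O => EC 1 | S n => EMul p (EPow p n) end.

Lemma Cmod_eval_EPow (z w : nat -> C) (p : expr) (n : nat) :
  Cmod (eval z w (EPow p n)) = Cmod (eval z w p) ^ n.
Proof. induction n as [|n IH]; simpl; [apply Cmod_1|]. now rewrite Cmod_mult, IH. Qed.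

Lemma uses_EPow (n m N : nat) (p : expr) : uses n m p -> uses n m (EPow p N).
Proof. intros H. induction N; simpl; tauto. Qed.

(** If [M < x], then [(M / x)^n] tends to 0 and eventually beats the constant [/ c]. *)
Lemma le_of_pow_le (x M c : R) : 0 <= x -> 0 <= M ->
  (forall n, x ^ n <= c * M ^ n) -> x <= M.
Proof.
  intros Hx HM H. destruct (Rle_or_lt x M) as [|Hlt]; trivial. exfalso.
  assert (Hc : 1 <= c) by (specialize (H O); simpl in H; lra).
  destruct (pow_lt_1_zero (M / x)) with (y := / c) as [n Hn].
  - rewrite Rabs_right by (apply Rle_ge, Rdiv_le_0_compat; lra).
    apply Rmult_lt_reg_r with x; [lra|]. unfold Rdiv. rewrite Rmult_assoc, Rinv_l by lra. lra.
  - apply Rinv_0_lt_compat. lra.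
  - specialize (Hn n (Nat.le_refl n)).
    rewrite Rabs_right in Hn by (apply Rle_ge, pow_le, Rdiv_le_0_compat; lra).
    unfold Rdiv in Hn. rewrite Rpow_mult_distr, pow_inv in Hn.
    assert (Hp : 0 < x ^ n) by (apply pow_lt; lra).
    specialize (H n).
    assert (Q : c * M ^ n < x ^ n).
    { apply Rmult_lt_compat_l with (r := c * x ^ n) in Hn;
        [|apply Rmult_lt_0_compat; lra].
      replace (c * x ^ n * (M ^ n * / x ^ n)) with (c * M ^ n) in Hn by (field; lra).
      replace (c * x ^ n * / c) with (x ^ n) in Hn by (field; lra). exact Hn. }
    lra.
Qed.

(* Eliminating the last square root [w]: for [p = a + b w] the two conjugates have sum [2 a]
   and product [a^2 - b^2 w^2] free of [w], which bounds [p] up to a factor 3; the factor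
   disappears on replacing [p] by its powers. *)
Lemma ev0_le_uses (m : nat) : forall n p M, uses n m p ->
  (forall s, Cmod (ev s p) <= M) -> Cmod (ev0 p) <= M.
Proof.
  induction m as [|m IH]; intros n p M Hu H.
  - apply (ev0_le_no_roots M _ n); trivial. intros y.
    (* Any sequence with even part [y] would do; halving the index yields one. *)
    set (s := fun j => y (Nat.div2 j)).
    assert (E : even_part s = y).
    { apply functional_extensionality. intros j. unfold even_part, s.
      now rewrite Nat.div2_double. }
    rewrite (eval_ext n 0 _ _ (fun k => gz k (even_part s)) (fun m => gw m s)); trivial.
    + apply H.
    + intros k _. now rewrite E.
    + intros j Hj. lia.
  (* Room is made for the variable [z (base m)] that replaces the square of the root. *)
  - set (N := max n (S (base m))).
    assert (Hu' : uses N (S m) p) by (apply (uses_mono n (S m)); trivial; lia).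
    assert (HM : 0 <= M) by (eapply Rle_trans; [apply Cmod_ge_0 | apply (H (fun _ => true))]).
    assert (K : forall q L, uses N (S m) q -> (forall s, Cmod (ev s q) <= L) ->
      Cmod (ev0 q) <= 3 * L).
    { clear p M Hu H Hu' HM. intros q L Hq H.
      assert (HL : 0 <= L) by (eapply Rle_trans; [apply Cmod_ge_0 | apply (H (fun _ => true))]).
      destruct (expr_split N m q ltac:(lia) Hq) as [a [b [Ha [Hb E]]]].
      assert (Es : forall s, ev s q = (ev s a + ev s b * gw m s)%C).
      { intros s. apply E. apply gw_sq. }
      assert (Inv : forall s r, uses N m r -> ev (flip m s) r = ev s r).
      { intros s r Hr. apply (eval_ext N m); trivial.
        - intros k _. now rewrite even_part_flip.
        - intros j Hj. apply gw_flip_neq. lia. }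
      assert (Ef : forall s, ev (flip m s) q = (ev s a - ev s b * gw m s)%C).
      { intros s. rewrite Es, !Inv, gw_flip_eq by assumption. ring. }
      set (f := EAdd (EZ (base m)) (EC (- center m))).
      set (d := ESub (EMul a a) (EMul (EMul b b) f)).
      assert (Bs : Cmod (ev0 a) <= L).
      { apply (IH N); trivial. intros s.
        assert (H1 := H s). assert (H2 := H (flip m s)). rewrite Es in H1. rewrite Ef in H2.
        assert (H3 : Cmod (2 * ev s a) <= L + L).
        { replace (2 * ev s a)%C with
            ((ev s a + ev s b * gw m s) + (ev s a - ev s b * gw m s))%C by ring.
          eapply Rle_trans; [apply Cmod_triangle | lra]. }
        rewrite Cmod_mult, Cmod_R, Rabs_right in H3 by lra. lra. }
      assert (Bd : Cmod (ev0 d) <= L * L).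
      { apply (IH N).
        - simpl. repeat split; trivial. lia.
        - intros s.
          replace (ev s d) with (ev s q * ev (flip m s) q)%C.
          + rewrite Cmod_mult. apply Rmult_le_compat; auto using Cmod_ge_0.
          + rewrite Es, Ef. unfold d, f, ev. rewrite eval_ESub. cbn [eval].
            replace (gz (base m) (even_part s) + - center m)%C with (gw m s * gw m s)%C
              by (rewrite gw_sq; ring).
            ring. }
      set (zeta := csqrt (- center m)).
      assert (Hz : (zeta * zeta = 0 - center m)%C)
        by (unfold zeta; rewrite csqrt_sq; ring).
      assert (E0 : ev0 q = (ev0 a + ev0 b * zeta)%C) by (apply E; exact Hz).
      assert (D0 : ((ev0 b * zeta) * (ev0 b * zeta) = ev0 a * ev0 a - ev0 d)%C).
      { unfold d, f, ev0. rewrite eval_ESub. cbn [eval]. fold ev0.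
        replace (RtoC 0 + - center m)%C with (zeta * zeta)%C by (rewrite Hz; ring). ring. }
      assert (B2 : Cmod (ev0 b * zeta) * Cmod (ev0 b * zeta) <= L * L + L * L).
      { rewrite <- (Cmod_mult (ev0 b * zeta)), D0.
        eapply Rle_trans; [apply Cmod_triangle|]. rewrite Cmod_opp, Cmod_mult.
        apply Rplus_le_compat; trivial. apply Rmult_le_compat; auto using Cmod_ge_0. }
      assert (P := Cmod_ge_0 (ev0 b * zeta)).
      (* The square is at most [2 L^2 <= (2 L)^2]; together with the bound [L] for [ev0 a] this
         gives the factor 3. *)
      assert (B3 : Cmod (ev0 b * zeta) <= 2 * L) by nra.
      rewrite E0. eapply Rle_trans; [apply Cmod_triangle | lra]. }
    apply (le_of_pow_le _ _ 3); [apply Cmod_ge_0 | exact HM|].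
    intros j. unfold ev0. rewrite <- Cmod_eval_EPow. apply K; [now apply uses_EPow|].
    intros s. unfold ev. rewrite Cmod_eval_EPow. apply pow_incr.
    split; [apply Cmod_ge_0 | apply H].
Qed.

Lemma ev0_le (p : expr) (M : R) : (forall s, Cmod (ev s p) <= M) -> Cmod (ev0 p) <= M.
Proof. destruct (uses_exists p) as [n [m H]]. now apply (ev0_le_uses m n). Qed.

(** * Holomorphic functions on the disc *)

Definition cderiv (h : C -> C) (z l : C) : Prop :=
  forall eps, 0 < eps -> exists delta, 0 < delta /\
    forall w, Cmod w < 1 -> Cmod (w - z) < delta ->
      Cmod (h w - h z - l * (w - z)) <= eps * Cmod (w - z).

Lemma holomorphic_cderiv (h : C -> C) (z : C) :
  holomorphic_on_disc h -> Cmod z < 1 -> exists l, cderiv h z l.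
Proof.
  intros H Hz. rewrite <- Cnorm_Cmod in Hz. destruct (H z Hz) as [l Hl].
  exists l. intros eps He. destruct (Hl eps He) as [d [Hd K]]. exists d. split; trivial.
  intros w Hw Hwz. rewrite <- Cnorm_Cmod in Hw, Hwz. specialize (K w Hw Hwz).
  rewrite !Cnorm_Cmod in K. exact K.
Qed.

Definition ccont (h : C -> C) (z : C) : Prop :=
  forall eps, 0 < eps -> exists delta, 0 < delta /\
    forall w, Cmod w < 1 -> Cmod (w - z) < delta -> Cmod (h w - h z) < eps.

Lemma cderiv_ccont (h : C -> C) (z l : C) : cderiv h z l -> ccont h z.
Proof.
  intros H eps He. destruct (H 1 Rlt_0_1) as [d [Hd K]].
  assert (P := Cmod_ge_0 l).
  exists (Rmin d (eps / (2 + Cmod l))). split.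
  - apply Rmin_glb_lt; trivial. apply Rdiv_lt_0_compat; lra.
  - intros w Hw Hwz.
    assert (H1 := Rlt_le_trans _ _ _ Hwz (Rmin_l _ _)).
    assert (H2 := Rlt_le_trans _ _ _ Hwz (Rmin_r _ _)).
    specialize (K w Hw H1).
    replace (h w - h z)%C with ((h w - h z - l * (w - z)) + l * (w - z))%C by ring.
    eapply Rle_lt_trans; [apply Cmod_triangle|]. rewrite Cmod_mult.
    assert (Q := Cmod_ge_0 (w - z)).
    apply Rmult_lt_compat_l with (r := 2 + Cmod l) in H2; [|lra].
    replace ((2 + Cmod l) * (eps / (2 + Cmod l))) with eps in H2 by (field; lra). nra.
Qed.

(** The mean value theorem on the segment from 0 to [z], applied to the real and the imaginary part
    of [h]; both are instances of the 1-Lipschitz [c] in the proof. *)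
Lemma cderiv_0_const (h : C -> C) :
  (forall z, Cmod z < 1 -> cderiv h z 0) -> forall z, Cmod z < 1 -> h z = h 0.
Proof.
  intros H z Hz.
  assert (Hpz := Cmod_ge_0 z).
  assert (G : forall c : C -> R, (forall u v, Rabs (c u - c v) <= Cmod (u - v)) ->
    c (h z) = c (h 0)).
  { intros c Hc.
    destruct (MVT_cor2 (fun t => c (h (RtoC t * z)%C)) (fun _ => 0) 0 1) as [t [E _]];
      [lra | |].
    - intros t Ht eps He.
      assert (Htz : Cmod (t * z) <= Cmod z)
        by (rewrite Cmod_mult, Cmod_R, Rabs_right by lra; nra).
      destruct (H (RtoC t * z)%C ltac:(lra) (eps / 2)) as [d [Hd K]]; [lra|].
      assert (Hm : 0 < Rmin d (1 - Cmod z)) by (apply Rmin_glb_lt; lra).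
      exists (mkposreal _ Hm). intros k Hk Hkd. simpl in Hkd.
      assert (H1 := Rlt_le_trans _ _ _ Hkd (Rmin_l _ _)).
      assert (H2 := Rlt_le_trans _ _ _ Hkd (Rmin_r _ _)).
      assert (Pk := Rabs_pos k).
      assert (Ed : (RtoC (t + k) * z - RtoC t * z = RtoC k * z)%C)
        by (rewrite RtoC_plus; ring).
      assert (Ek : Cmod (RtoC k * z) <= Rabs k).
      { rewrite Cmod_mult, Cmod_R. nra. }
      assert (Hw : Cmod (RtoC (t + k) * z) < 1).
      { replace (RtoC (t + k) * z)%C with (RtoC t * z + RtoC k * z)%C
          by (rewrite RtoC_plus; ring).
        eapply Rle_lt_trans; [apply Cmod_triangle | lra]. }
      specialize (K (RtoC (t + k) * z)%C Hw). rewrite Ed in K. specialize (K ltac:(lra)).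
      replace (_ - _ - 0 * _)%C with (h (RtoC (t + k) * z) - h (RtoC t * z))%C in K by ring.
      assert (B := Hc (h (RtoC (t + k) * z)%C) (h (RtoC t * z)%C)).
      rewrite Rminus_0_r. unfold Rdiv. rewrite Rabs_mult, Rabs_inv.
      assert (Pk' : 0 < Rabs k) by now apply Rabs_pos_lt.
      apply Rmult_lt_reg_r with (Rabs k); trivial.
      rewrite Rmult_assoc, Rinv_l by lra. nra.
    - replace (RtoC 1 * z)%C with z in E by ring.
      replace (RtoC 0 * z)%C with (RtoC 0) in E by ring. lra. }
  apply injective_projections; apply G; intros u v.
  - apply (Cmod_fst (u - v)%C).
  - apply (Cmod_snd (u - v)%C).
Qed.

(** Increments of [h] are real, so [l * u] has imaginary part 0 for every unit direction [u]. The
    directions 1 and [Ci] give the imaginary and the real part of [l]. *)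
Lemma cderiv_real_0 (h : C -> C) (z l : C) : Cmod z < 1 ->
  (forall w, Cmod w < 1 -> snd (h w) = 0) -> cderiv h z l -> l = 0.
Proof.
  intros Hz Hr H. apply Ceq_of_small. intros eps He.
  destruct (H (eps / 2)) as [d [Hd K]]; [lra|].
  assert (T : exists t, 0 < t /\ t < d /\ t < 1 - Cmod z).
  { exists (Rmin d (1 - Cmod z) / 2).
    assert (M : 0 < Rmin d (1 - Cmod z)) by (apply Rmin_glb_lt; lra).
    assert (M1 := Rmin_l d (1 - Cmod z)). assert (M2 := Rmin_r d (1 - Cmod z)). lra. }
  destruct T as [t [Ht [Htd Htz]]].
  assert (Q : forall u : C, Cmod u = 1 -> Rabs (snd (l * u)%C) <= eps / 2).
  { intros u Hu.
    assert (E : Cmod (t * u) = t) by (rewrite Cmod_mult, Hu, Cmod_R, Rabs_right; lra).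
    assert (Hw : Cmod (z + t * u) < 1).
    { eapply Rle_lt_trans; [apply Cmod_triangle | lra]. }
    assert (Ew : (z + t * u - z = t * u)%C) by ring.
    specialize (K (z + t * u)%C Hw). rewrite Ew in K.
    rewrite E in K. specialize (K Htd).
    assert (S := Cmod_snd (h (z + t * u) - h z - l * (t * u))%C).
    assert (Es : snd (h (z + t * u) - h z - l * (t * u))%C = - (t * snd (l * u)%C)).
    { assert (R1 := Hr _ Hw). assert (R2 := Hr z Hz).
      destruct (h (z + t * u)%C) as [h1 h2]. destruct (h z) as [h3 h4].
      unfold Cminus, Cplus, Copp, Cmult, RtoC. simpl in *. rewrite R1, R2. ring. }
    rewrite Es, Rabs_Ropp, Rabs_mult, (Rabs_right t) in S by lra.
    apply Rmult_le_reg_l with t; [lra|]. lra. }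
  assert (Q1 := Q 1 Cmod_1). assert (Q2 := Q Ci Cmod_Ci).
  rewrite Cmult_1_r in Q1. cbn [snd fst Cmult Ci] in Q2.
  replace (fst l * 1 + snd l * 0) with (fst l) in Q2 by ring.
  replace (l - 0)%C with l by ring.
  eapply Rle_trans; [apply Cmod_le_sum | lra].
Qed.

(** * Square roots along small circles *)

Definition cis (x : R) : C := (cos x, sin x).

Lemma Cmod_cis (x : R) : Cmod (cis x) = 1.
Proof.
  assert (H := sin2_cos2 x). unfold Rsqr in H.
  unfold Cmod, cis; cbn [fst snd]. replace (_ + _) with 1 by lra. apply sqrt_1.
Qed.

Lemma cis_plus (x y : R) : cis (x + y) = (cis x * cis y)%C.
Proof. unfold cis, Cmult; simpl. rewrite cos_plus, sin_plus. f_equal; ring. Qed.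

(* On a small circle about [z0] the values of [F - a] wind once around 0,
   so that [F - a] has no continuous square root there. *)
Lemma no_local_root (F : C -> C) (z0 l : C) : Cmod z0 < 1 -> cderiv F z0 l -> l <> 0 ->
  exists eta, 0 < eta /\ forall (a : C) (G : C -> C), Cmod (a - F z0) < eta ->
    (forall z, Cmod z < 1 -> ccont G z) ->
    ~ (forall z, Cmod z < 1 -> (G z * G z = F z - a)%C).
Proof.
  intros Hz0 HF Hl.
  assert (Pl : 0 < Cmod l) by now apply Cmod_gt_0.
  destruct (HF (Cmod l / 4)) as [d [Hd K]]; [lra|].
  assert (T : exists r, 0 < r /\ r < d /\ r < 1 - Cmod z0).
  { exists (Rmin d (1 - Cmod z0) / 2).
    assert (M : 0 < Rmin d (1 - Cmod z0)) by (apply Rmin_glb_lt; lra).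
    assert (M1 := Rmin_l d (1 - Cmod z0)). assert (M2 := Rmin_r d (1 - Cmod z0)). lra. }
  destruct T as [r [Hr [Hrd Hrz]]].
  (* The circle of radius [r] is mapped nearly onto one of radius [Cmod l * r]; the linearisation
     error and the displacement of [a] from [F z0] each take at most a quarter of that radius. *)
  exists (Cmod l * r / 4). split; [apply Rdiv_lt_0_compat; [now apply Rmult_lt_0_compat | lra]|].
  intros a G Ha HG HGF.
  set (kappa := csqrt (l * r)).
  assert (Ek : (kappa * kappa = l * r)%C) by apply csqrt_sq.
  assert (Hr0 : RtoC r <> 0) by (intros E; apply RtoC_inj in E; lra).
  assert (Hk : kappa <> 0).
  { intros E. apply (Cmult_neq_0 l r Hl Hr0). now rewrite <- Ek, E, Cmult_0_r. }
  set (path := fun x => (z0 + r * cis x)%C).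
  assert (Hmod : forall x, Cmod (r * cis x) = r).
  { intros x. rewrite Cmod_mult, Cmod_cis, Cmod_R, Rabs_right; lra. }
  assert (Hpath : forall x, Cmod (path x) < 1).
  { intros x. unfold path. eapply Rle_lt_trans; [apply Cmod_triangle|]. rewrite Hmod. lra. }
  (* Half of the expected rotation is divided out, so that [y^2] stays close to 1. The real part of
     [y] then has no zero, yet [y] changes sign after a full turn, against the intermediate value
     theorem. *)
  set (y := fun x => (G (path x) * (cis (- x / 2) * / kappa))%C).
  assert (Hy : forall x, fst (y x) <> 0).
  { intros x E.
    assert (Ey : (y x * y x = (F (path x) - a) * cis (- x) * / (l * r))%C).
    { rewrite <- (HGF _ (Hpath x)), <- Ek.
      replace (- x) with (- x / 2 + - x / 2) by field. rewrite cis_plus.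
      unfold y. field. exact Hk. }
    assert (Eu : (y x * y x - 1 = (F (path x) - a - l * (r * cis x)) * (cis (- x) * / (l * r)))%C).
    { assert (E1 : (cis x * cis (- x) = 1)%C).
      { rewrite <- cis_plus, Rplus_opp_r. unfold cis. rewrite cos_0, sin_0. reflexivity. }
      rewrite Ey.
      replace ((F (path x) - a - l * (r * cis x)) * (cis (- x) * / (l * r)))%C with
        ((F (path x) - a) * cis (- x) * / (l * r) - (cis x * cis (- x)) * (l * r * / (l * r)))%C
        by ring.
      rewrite E1, Cinv_r by (now apply Cmult_neq_0). ring. }
    assert (Bn : Cmod (F (path x) - a - l * (r * cis x)) <= Cmod l * r / 2).
    { assert (Ep : (path x - z0 = r * cis x)%C) by (unfold path; ring).
      specialize (K (path x) (Hpath x)). rewrite Ep, Hmod in K. specialize (K Hrd).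
      replace (F (path x) - a - l * (r * cis x))%C with
        ((F (path x) - F z0 - l * (r * cis x)) + - (a - F z0))%C by ring.
      eapply Rle_trans; [apply Cmod_triangle|]. rewrite Cmod_opp. lra. }
    assert (B : Cmod (y x * y x - 1) <= / 2).
    { rewrite Eu, Cmod_mult, Cmod_mult, Cmod_cis, Cmod_inv, Cmod_mult, Cmod_R,
        (Rabs_right r) by (try lra; now apply Cmult_neq_0).
      apply Rmult_le_reg_r with (Cmod l * r); [now apply Rmult_lt_0_compat|].
      rewrite Rmult_1_l, Rmult_assoc, Rinv_l by nra. lra. }
    (* With real part 0, [y x] would have a square [<= 0], at distance at least 1 from 1. *)
    assert (B' := Rle_trans _ _ _ (Cmod_fst _) B).
    cbn [fst Cminus Cplus Copp Cmult RtoC] in B'. rewrite E in B'.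
    apply Rabs_le_between in B'. nra. }
  assert (Hcont : continuity (fun x => fst (y x))).
  { assert (Hg : forall c : C -> R, (forall u v, Rabs (c u - c v) <= Cmod (u - v)) ->
      continuity (fun x => c (G (path x)))).
    { intros c Hc x eps He.
      destruct (HG (path x) (Hpath x) eps He) as [e [He' HK]].
      exists (e / (2 * r)). split; [apply Rdiv_lt_0_compat; lra|].
      intros x' [_ Hx']. simpl in Hx' |- *. unfold Rdist in *.
      eapply Rle_lt_trans; [apply Hc|]. apply HK; [apply Hpath|].
      replace (path x' - path x)%C with (r * (cis x' - cis x))%C by (unfold path; ring).
      rewrite Cmod_mult, Cmod_R, Rabs_right by lra.
      destruct (sin_cos_lipschitz x' x) as [L1 L2].
      assert (L := Cmod_le_sum (cis x' - cis x)).
      cbn [fst snd Cminus Cplus Copp cis] in L. unfold Rminus in *.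
      apply Rmult_lt_compat_l with (r := 2 * r) in Hx'; [|lra].
      replace (2 * r * (e / (2 * r))) with e in Hx' by (field; lra). nra. }
    assert (H1 := Hg fst (fun u v => Cmod_fst (u - v)%C)).
    assert (H2 := Hg snd (fun u v => Cmod_snd (u - v)%C)).
    intros x. unfold y. cbn [fst snd Cmult cis].
    set (k1 := fst (/ kappa)%C). set (k2 := snd (/ kappa)%C).
    apply (continuity_pt_minus
      (fun x => fst (G (path x)) * (cos (- x / 2) * k1 - sin (- x / 2) * k2))
      (fun x => snd (G (path x)) * (cos (- x / 2) * k2 + sin (- x / 2) * k1))).
    - apply (continuity_pt_mult (fun x => fst (G (path x)))
        (fun x => cos (- x / 2) * k1 - sin (- x / 2) * k2)); [apply H1|]. reg.
    - apply (continuity_pt_mult (fun x => snd (G (path x)))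
        (fun x => cos (- x / 2) * k2 + sin (- x / 2) * k1)); [apply H2|]. reg. }
  destruct (IVT_cor (fun x => fst (y x)) 0 (2 * PI) Hcont) as [x [_ Hx]].
  - assert (P := PI_RGT_0). lra.
  - assert (E : y (2 * PI) = (- y 0)%C).
    { assert (Ep : path (2 * PI) = path 0).
      { unfold path, cis. now rewrite cos_2PI, sin_2PI, cos_0, sin_0. }
      unfold y. rewrite Ep.
      replace (- (2 * PI) / 2) with (- 0 / 2 + - PI) by field. rewrite cis_plus.
      replace (cis (- PI)) with (- (1))%C.
      - ring.
      - unfold cis. rewrite cos_neg, sin_neg, cos_PI, sin_PI. unfold Copp, RtoC; simpl.
        f_equal; ring. }
    rewrite E. cbn [fst Copp]. nra.
  - exact (Hy x Hx).
Qed.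

(** Near [z0] the value of [G] is [G z0] or its negative, and continuity excludes the negative. So
    [G] is locally constant and its derivative vanishes. *)
Lemma cderiv_sq_const (G : C -> C) (c z0 l : C) : Cmod z0 < 1 ->
  (forall z, Cmod z < 1 -> (G z * G z)%C = c) -> cderiv G z0 l -> l = 0.
Proof.
  intros Hz HG Hd. destruct (classic (l = 0)) as [|Hl]; trivial. exfalso.
  assert (Pl : 0 < Cmod l) by now apply Cmod_gt_0.
  assert (L : exists d, 0 < d /\ forall w, Cmod w < 1 -> Cmod (w - z0) < d -> G w = G z0).
  { destruct (classic (G z0 = 0)) as [E|E].
    - exists 1. split; [lra|]. intros w Hw _. rewrite E.
      assert (Q := f_equal Cmod (HG w Hw)). rewrite <- (HG z0 Hz), E, Cmult_0_r, Cmod_0, Cmod_mult in Q.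
      apply Cmod_eq_0. nra.
    - assert (P : 0 < Cmod (G z0)) by now apply Cmod_gt_0.
      destruct (cderiv_ccont _ _ _ Hd _ P) as [d [Hd0 K]]. exists d. split; trivial.
      intros w Hw Hwz. specialize (K w Hw Hwz).
      assert (Q : ((G w - G z0) * (G w + G z0) = 0)%C).
      { replace ((G w - G z0) * (G w + G z0))%C with (G w * G w - G z0 * G z0)%C by ring.
        rewrite (HG w Hw), (HG z0 Hz). ring. }
      destruct (classic (G w - G z0 = 0)%C) as [E0|N0].
      + replace (G w) with (G w - G z0 + G z0)%C by ring. rewrite E0. ring.
      + exfalso. destruct (classic (G w + G z0 = 0)%C) as [E1|N1].
        * replace (G w - G z0)%C with ((G w + G z0) - 2 * G z0)%C in K by ring.
          rewrite E1 in K. replace (0 - 2 * G z0)%C with (- (2 * G z0))%C in K by ring.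
          rewrite Cmod_opp, Cmod_mult, Cmod_R, Rabs_right in K by lra. lra.
        * exact (Cmult_neq_0 _ _ N0 N1 Q). }
  destruct L as [d [Hd0 L]].
  destruct (Hd (Cmod l / 2)) as [d' [Hd' K]]; [lra|].
  set (t := Rmin (Rmin d d') (1 - Cmod z0) / 2).
  assert (T : 0 < t /\ t < d /\ t < d' /\ t < 1 - Cmod z0).
  { assert (M : 0 < Rmin (Rmin d d') (1 - Cmod z0)) by (repeat apply Rmin_glb_lt; lra).
    assert (M1 := Rmin_l (Rmin d d') (1 - Cmod z0)).
    assert (M2 := Rmin_r (Rmin d d') (1 - Cmod z0)).
    assert (M3 := Rmin_l d d'). assert (M4 := Rmin_r d d'). unfold t. lra. }
  clearbody t. destruct T as [T0 [T1 [T2 T3]]].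
  assert (E : (z0 + t - z0 = t)%C) by ring.
  assert (Hm : Cmod t = t) by (rewrite Cmod_R, Rabs_right; lra).
  assert (Hw : Cmod (z0 + t) < 1) by (eapply Rle_lt_trans; [apply Cmod_triangle | lra]).
  specialize (K (z0 + t)%C Hw). specialize (L (z0 + t)%C Hw). rewrite E, Hm in K, L.
  specialize (K T2). rewrite (L T1) in K.
  replace (G z0 - G z0 - l * t)%C with (- (l * t))%C in K by ring.
  rewrite Cmod_opp, Cmod_mult, Hm in K. nra.
Qed.

(** * Continuous functions on the compact space *)

Lemma mult_close (a b a' b' : C) (d M N : R) : d <= 1 ->
  Cmod (a - a') < d -> Cmod (b - b') < d -> Cmod a <= M -> Cmod b <= N ->
  Cmod (a * b - a' * b') <= d * (M + N + 1).
Proof.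
  intros Hd Ha Hb HM HN.
  assert (P1 := Cmod_ge_0 (a - a')). assert (P2 := Cmod_ge_0 (b - b')).
  assert (P3 := Cmod_ge_0 a). assert (P4 := Cmod_ge_0 b).
  replace (a * b - a' * b')%C with
    (a * (b - b') + ((a - a') * b + - ((a - a') * (b - b'))))%C by ring.
  eapply Rle_trans; [apply Cmod_triangle|].
  assert (T := Cmod_triangle ((a - a') * b) (- ((a - a') * (b - b')))).
  rewrite Cmod_opp in T. rewrite !Cmod_mult in *. nra.
Qed.

Lemma mult_modulus (M N eps : R) : 0 <= M -> 0 <= N -> 0 < eps ->
  exists d, 0 < d <= 1 /\ d <= eps /\ d * (M + N + 1) < eps.
Proof.
  intros HM HN He. exists (Rmin 1 (eps / (M + N + 2))).
  assert (P : 0 < eps / (M + N + 2)) by (apply Rdiv_lt_0_compat; lra).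
  assert (H1 := Rmin_l 1 (eps / (M + N + 2))). assert (H2 := Rmin_r 1 (eps / (M + N + 2))).
  assert (H0 : 0 < Rmin 1 (eps / (M + N + 2))) by (apply Rmin_glb_lt; lra).
  set (d := Rmin _ _) in *. clearbody d.
  assert (Q : d * (M + N + 2) <= eps).
  { apply Rmult_le_compat_r with (r := M + N + 2) in H2; [|lra].
    replace (eps / (M + N + 2) * (M + N + 2)) with eps in H2 by (field; lra). exact H2. }
  split; [lra|]. split; nra.
Qed.

Section Algebra.

Variables (K : Type) (T : (K -> Prop) -> Prop).
Hypotheses (HT : is_topology T) (Hcomp : compact_space T) (Hhaus : hausdorff T).
Variable e : (nat -> bool) -> K.
Hypothesis e_cont : forall W, T W -> cantor_open (fun s => W (e s)).
Hypothesis e_inj : forall s t, e s = e t -> s = t.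
Hypothesis e_emb : forall V, cantor_open V -> exists W, T W /\ forall s, V s <-> W (e s).

Lemma open_of_local (P : K -> Prop) :
  (forall x, P x -> exists U, T U /\ U x /\ forall y, U y -> P y) -> T P.
Proof.
  intros H. destruct HT as [_ [_ HU]].
  set (I := {U : K -> Prop | T U /\ forall y, U y -> P y}).
  replace P with (fun x => exists i : I, proj1_sig i x).
  - apply HU. intros [U [HU1 HU2]]. exact HU1.
  - apply functional_extensionality. intros x. apply propositional_extensionality. split.
    + intros [[U [HU1 HU2]] Ux]. exact (HU2 x Ux).
    + intros Px. destruct (H x Px) as [U [HU1 [Ux HU2]]].
      exists (exist _ U (conj HU1 HU2)). exact Ux.
Qed.

Lemma open_and (U V : K -> Prop) : T U -> T V -> T (fun x => U x /\ V x).
Proof. destruct HT as [_ [H _]]. apply H. Qed.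

Lemma open_all : T (fun _ => True).
Proof. apply HT. Qed.

Definition cont (f : K -> C) : Prop := forall x eps, 0 < eps ->
  exists U, T U /\ U x /\ forall y, U y -> Cmod (f y - f x) < eps.

Definition rcont (f : K -> R) : Prop := forall x eps, 0 < eps ->
  exists U, T U /\ U x /\ forall y, U y -> Rabs (f y - f x) < eps.

Lemma continuousC_iff (f : K -> C) : continuousC T f <-> cont f.
Proof.
  split; intros H x eps He; destruct (H x eps He) as [U [HU [Ux HUy]]];
    exists U; split; trivial; split; trivial; intros y Uy; specialize (HUy y Uy).
  - rewrite Cnorm_Cmod in HUy. exact HUy.
  - rewrite Cnorm_Cmod. exact HUy.
Qed.

Lemma cont_const (c : C) : cont (fun _ => c).
Proof.
  intros x eps He. exists (fun _ => True). split; [apply open_all|]. split; trivial.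
  intros y _. replace (c - c)%C with (RtoC 0) by ring. now rewrite Cmod_0.
Qed.

Lemma cont_plus (f g : K -> C) : cont f -> cont g -> cont (fun x => f x + g x)%C.
Proof.
  intros Hf Hg x eps He.
  destruct (Hf x (eps / 2)) as [U [HU [Ux HfU]]]; [lra|].
  destruct (Hg x (eps / 2)) as [V [HV [Vx HgV]]]; [lra|].
  exists (fun y => U y /\ V y). split; [now apply open_and|]. split; [tauto|].
  intros y [Uy Vy]. specialize (HfU y Uy). specialize (HgV y Vy).
  replace (_ - _)%C with ((f y - f x) + (g y - g x))%C by ring.
  eapply Rle_lt_trans; [apply Cmod_triangle | lra].
Qed.

Lemma cont_mult (f g : K -> C) : cont f -> cont g -> cont (fun x => f x * g x)%C.
Proof.
  intros Hf Hg x eps He.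
  destruct (mult_modulus (Cmod (f x)) (Cmod (g x)) eps) as [d [Hd [_ Hde]]];
    auto using Cmod_ge_0.
  destruct (Hf x d) as [U [HU [Ux HfU]]]; [lra|].
  destruct (Hg x d) as [V [HV [Vx HgV]]]; [lra|].
  exists (fun y => U y /\ V y). split; [now apply open_and|]. split; [tauto|].
  intros y [Uy Vy]. specialize (HfU y Uy). specialize (HgV y Vy).
  rewrite Cmod_minus_sym in HfU, HgV |- *. eapply Rle_lt_trans; [|exact Hde].
  apply mult_close; trivial; try lra.
Qed.

Lemma cont_inv (f : K -> C) : cont f -> (forall x, f x <> 0) -> cont (fun x => / f x)%C.
Proof.
  intros Hf Hn x eps He.
  assert (P : 0 < Cmod (f x)) by (apply Cmod_gt_0, Hn).
  set (m := Cmod (f x)) in *.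
  assert (P2 : 0 < eps * m * m / 2).
  { apply Rdiv_lt_0_compat; [|lra]. repeat apply Rmult_lt_0_compat; trivial. }
  destruct (Hf x (Rmin (m / 2) (eps * m * m / 2))) as [U [HU [Ux HfU]]];
    [apply Rmin_glb_lt; lra|].
  exists U. split; trivial. split; trivial. intros y Uy. specialize (HfU y Uy).
  assert (H1 := Rlt_le_trans _ _ _ HfU (Rmin_l _ _)).
  assert (H2 := Rlt_le_trans _ _ _ HfU (Rmin_r _ _)).
  assert (H3 := Cmod_triangle_rev (f x) (f y)). rewrite Cmod_minus_sym in H3. fold m in H3.
  replace (/ f y - / f x)%C with (- ((f y - f x) / (f y * f x)))%C by (field; split; apply Hn).
  rewrite Cmod_opp, Cmod_div, Cmod_mult by (apply Cmult_neq_0; apply Hn). fold m.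
  assert (Hy : m / 2 < Cmod (f y)) by lra.
  apply Rmult_lt_reg_r with (Cmod (f y) * m); [nra|].
  unfold Rdiv. rewrite Rmult_assoc, Rinv_l by nra.
  assert (m * eps * (m / 2) < m * eps * Cmod (f y))
    by (apply Rmult_lt_compat_l; trivial; now apply Rmult_lt_0_compat).
  lra.
Qed.

Lemma cont_RtoC (f : K -> R) : rcont f -> cont (fun x => RtoC (f x)).
Proof.
  intros H x eps He. destruct (H x eps He) as [U [HU [Ux HUy]]].
  exists U. split; trivial. split; trivial. intros y Uy.
  rewrite <- RtoC_minus, Cmod_R. auto.
Qed.

Lemma rcont_proj (f : K -> C) (c : C -> R) : cont f ->
  (forall u v, Rabs (c u - c v) <= Cmod (u - v)) -> rcont (fun x => c (f x)).
Proof.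
  intros H Hc x eps He. destruct (H x eps He) as [U [HU [Ux HUy]]].
  exists U. split; trivial. split; trivial. intros y Uy.
  eapply Rle_lt_trans; [apply Hc | auto].
Qed.

Lemma cont_pair (f g : K -> R) : rcont f -> rcont g -> cont (fun x => (f x, g x)).
Proof.
  intros Hf Hg.
  replace (fun x => (f x, g x)) with (fun x => RtoC (f x) + Ci * RtoC (g x))%C.
  - apply cont_plus; [now apply cont_RtoC|].
    apply cont_mult; [apply cont_const | now apply cont_RtoC].
  - apply functional_extensionality. intros x.
    unfold Cplus, Cmult, Ci, RtoC; simpl. f_equal; ring.
Qed.

(** * The embedded Cantor set is closed, and functions extend from it *)

Lemma open_neq (x : K) : T (fun y => y <> x).
Proof.
  apply open_of_local. intros y Hy. destruct (Hhaus y x Hy) as [U [V [HU [HV [Uy [Vx D]]]]]].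
  exists U. split; trivial. split; trivial. intros z Uz ->. exact (D x (conj Uz Vx)).
Qed.

(* A point adherent to the image is adherent to the images of a nested sequence
   of cylinders, hence equal to the image of their common point. *)
Lemma image_closed : T (fun x => ~ exists s, x = e s).
Proof.
  apply open_of_local. intros x Hx. apply NNPP. intros Hno.
  set (Q := fun n s => forall U, T U -> U x -> exists t, agree n s t /\ U (e t)).
  assert (Q0 : Q O (fun _ => true)).
  { intros U HU Ux. apply NNPP. intros Hn. apply Hno. exists U. split; trivial. split; trivial.
    intros y Uy [t ->]. apply Hn. exists t. split; trivial. intros k Hk. lia. }
  assert (QS : forall n s, Q n s -> exists s', agree n s s' /\ Q (S n) s').
  (* If neither digit could be appended at position [n], each would be excluded by a neighbourhood
     of [x], and the intersection of the two would miss the image of the whole cylinder. *)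
  { intros n s HQ. apply NNPP. intros Hn.
    set (st := fun b k => if Nat.eqb k n then b else s k).
    assert (Hst : forall b, exists U, T U /\ U x /\
      forall t, agree n s t -> t n = b -> ~ U (e t)).
    { intros b. apply NNPP. intros Hb. apply Hn. exists (st b). split.
      - intros k Hk. unfold st. destruct (Nat.eqb_spec k n); trivial. lia.
      - intros U HU Ux. apply NNPP. intros Hc. apply Hb. exists U. split; trivial.
        split; trivial. intros t Ht Htn Ut. apply Hc. exists t. split; trivial.
        intros k Hk. unfold st. destruct (Nat.eqb_spec k n) as [->|]; [now symmetry|].
        apply Ht. lia. }
    destruct (Hst true) as [U [HU [Ux HUt]]]. destruct (Hst false) as [V [HV [Vx HVt]]].
    destruct (HQ _ (open_and U V HU HV) (conj Ux Vx)) as [t [Ht [Ut Vt]]].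
    destruct (t n) eqn:E; [apply (HUt t) | apply (HVt t)]; trivial. }
  set (step := fun n (p : {s | Q n s}) =>
    let H := constructive_indefinite_description _ (QS n (proj1_sig p) (proj2_sig p)) in
    exist (Q (S n)) (proj1_sig H) (proj2 (proj2_sig H))).
  set (seq := nat_rect (fun n => {s | Q n s}) (exist (Q O) _ Q0) step).
  assert (Hstep : forall n, agree n (proj1_sig (seq n)) (proj1_sig (seq (S n)))).
  { intros n. simpl. now destruct constructive_indefinite_description as [s' [A B]]. }
  (* Digit [k] is final from stage [k + 1] on. *)
  set (s := fun k => proj1_sig (seq (S k)) k).
  assert (Hs : forall n, agree n (proj1_sig (seq n)) s).
  { induction n as [|n IH]; intros k Hk; [lia|].
    destruct (Nat.eq_dec k n) as [->|]; [reflexivity|].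
    rewrite <- (Hstep n k) by lia. apply IH. lia. }
  apply Hx. exists s. apply NNPP. intros Hxs.
  destruct (Hhaus x (e s) Hxs) as [U [V [HU [HV [Ux [Vs D]]]]]].
  destruct (e_cont V HV s Vs) as [n Hn].
  destruct (proj2_sig (seq n) U HU Ux) as [t [Ht Ut]].
  apply (D (e t)). split; trivial. apply Hn. intros k Hk.
  rewrite <- (Ht k Hk). now apply Hs.
Qed.

Definition e_inv (x : K) : nat -> bool :=
  epsilon (inhabits (fun _ => true)) (fun s => x = e s).

Lemma e_inv_e (s : nat -> bool) : e_inv (e s) = s.
Proof.
  symmetry. apply e_inj. unfold e_inv. apply epsilon_spec. now exists s.
Qed.

Lemma extension_real (h : (nat -> bool) -> R) (M : R) :
  (forall eps, 0 < eps -> exists n, forall s t, agree n s t -> Rabs (h s - h t) < eps) ->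
  (forall s, Rabs (h s) <= M) -> exists H, rcont H /\ forall s, H (e s) = h s.
Proof.
  intros Hc HM.
  destruct (Tietze.continuous_extension K T (fun x => exists s, x = e s)
    (fun x => h (e_inv x)) M HT Hcomp Hhaus image_closed) as [g [G1 G2]].
  - intros x _. apply HM.
  - intros x eps [s ->] He.
    (* As [e] is an embedding, an open set of [K] cuts this neighbourhood out of the image. *)
    destruct (e_emb (fun t => Rabs (h t - h s) < eps)) as [W [HW E]].
    + intros t Ht. destruct (Hc (eps - Rabs (h t - h s))) as [n Hn]; [lra|].
      exists n. intros t' Ht'. specialize (Hn t' t Ht').
      replace (h t' - h s) with ((h t' - h t) + (h t - h s)) by ring.
      eapply Rle_lt_trans; [apply Rabs_triang | lra].
    + exists W. split; trivial. split.
      * apply E. rewrite Rminus_diag, Rabs_R0. exact He.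
      * intros y Wy [t ->]. rewrite !e_inv_e. now apply E.
  - exists g. split; [exact G2|]. intros s. rewrite G1 by now exists s. now rewrite e_inv_e.
Qed.

Lemma extension (g : (nat -> bool) -> C) (M : R) :
  ucont g -> (forall s, Cmod (g s) <= M) -> exists G, cont G /\ forall s, G (e s) = g s.
Proof.
  intros Hg HM.
  destruct (extension_real (fun s => fst (g s)) M) as [G1 [C1 E1]].
  - intros eps He. destruct (Hg eps He) as [n Hn]. exists n. intros s t H.
    eapply Rle_lt_trans; [apply (Cmod_fst (g s - g t)) | now apply Hn].
  - intros s. eapply Rle_trans; [apply Cmod_fst | apply HM].
  - destruct (extension_real (fun s => snd (g s)) M) as [G2 [C2 E2]].
    + intros eps He. destruct (Hg eps He) as [n Hn]. exists n. intros s t H.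
      eapply Rle_lt_trans; [apply (Cmod_snd (g s - g t)) | now apply Hn].
    + intros s. eapply Rle_trans; [apply Cmod_snd | apply HM].
    + exists (fun x => (G1 x, G2 x)). split; [now apply cont_pair|].
      intros s. rewrite E1, E2. now destruct (g s).
Qed.

(** Tietze extension of the indicator function of [x] from the closed set formed by [x], [y] and the
    image. It is continuous there because [x] is an isolated point of that set. *)
Lemma bump (x y : K) : (forall s, x <> e s) -> x <> y ->
  exists u, rcont u /\ u x = 1 /\ u y = 0 /\ forall s, u (e s) = 0.
Proof.
  intros Hx Hy.
  set (F := fun z => z = x \/ z = y \/ exists s, z = e s).
  set (f := fun z => if excluded_middle_informative (z = x) then 1 else 0).
  assert (Hf : forall z, z <> x -> f z = 0).
  { intros z Hz. unfold f. now destruct excluded_middle_informative. }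
  assert (O : T (fun z => z <> y /\ ~ exists s, z = e s)).
  { apply open_and; [apply open_neq | apply image_closed]. }
  destruct (Tietze.continuous_extension K T F f 1 HT Hcomp Hhaus) as [g [G1 G2]].
  - replace (fun z => ~ F z) with (fun z => z <> x /\ (z <> y /\ ~ exists s, z = e s)).
    + apply open_and; [apply open_neq | exact O].
    + apply functional_extensionality. intros z. apply propositional_extensionality.
      unfold F. tauto.
  - intros z _. unfold f. destruct excluded_middle_informative;
      [rewrite Rabs_R1 | rewrite Rabs_R0]; lra.
  - intros z eps Hz He. destruct (classic (z = x)) as [->|Hzx].
    + exists (fun z => z <> y /\ ~ exists s, z = e s). split; [exact O|]. split.
      * split; trivial. intros [s Hs]. exact (Hx s Hs).
      * intros z [N1 N2] [->|[Hz'|Hz']]; try contradiction.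
        rewrite Rminus_diag, Rabs_R0. exact He.
    + exists (fun z => z <> x). split; [apply open_neq|]. split; trivial.
      intros z' Hz' _. rewrite !Hf, Rminus_diag, Rabs_R0 by assumption. exact He.
  - exists g. split; [exact G2|]. split; [|split].
    + rewrite G1 by now left. unfold f. now destruct excluded_middle_informative.
    + rewrite G1 by (right; now left). apply Hf. now apply not_eq_sym.
    + intros s. rewrite G1 by (right; right; now exists s). apply Hf.
      intros E. exact (Hx s (eq_sym E)).
Qed.

(** * The uniform algebra *)

Definition alg (f : K -> C) : Prop := cont f /\
  forall eps, 0 < eps -> exists p, forall s, Cmod (f (e s) - ev s p) < eps.

Lemma alg_const_on_image (f : K -> C) (c : C) : cont f -> (forall s, f (e s) = c) -> alg f.
Proof.
  intros Hf Hc. split; trivial. intros eps He. exists (EC c). intros s.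
  unfold ev; simpl. rewrite Hc. replace (c - c)%C with (RtoC 0) by ring. now rewrite Cmod_0.
Qed.

Lemma alg_const (c : C) : alg (fun _ => c).
Proof. apply (alg_const_on_image _ c); [apply cont_const | reflexivity]. Qed.

Lemma alg_plus (f g : K -> C) : alg f -> alg g -> alg (fun x => f x + g x)%C.
Proof.
  intros [Cf Hf] [Cg Hg]. split; [now apply cont_plus|]. intros eps He.
  destruct (Hf (eps / 2)) as [p Hp]; [lra|]. destruct (Hg (eps / 2)) as [q Hq]; [lra|].
  exists (EAdd p q). intros s. specialize (Hp s). specialize (Hq s).
  unfold ev in *; simpl. set (a := eval _ _ p) in *. set (b := eval _ _ q) in *.
  replace (_ - _)%C with ((f (e s) - a) + (g (e s) - b))%C by ring.
  eapply Rle_lt_trans; [apply Cmod_triangle | lra].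
Qed.

Lemma alg_bounded (f : K -> C) : alg f -> exists M, 0 <= M /\ forall s, Cmod (f (e s)) <= M.
Proof.
  intros [_ Hf]. destruct (Hf 1 Rlt_0_1) as [p Hp]. destruct (ev_bounded p) as [M [HM B]].
  exists (M + 1). split; [lra|]. intros s. specialize (Hp s). specialize (B s).
  assert (R := Cmod_triangle_rev (f (e s)) (ev s p)). lra.
Qed.

Lemma alg_mult (f g : K -> C) : alg f -> alg g -> alg (fun x => f x * g x)%C.
Proof.
  intros Af Ag.
  destruct (alg_bounded f Af) as [M [HM BM]]. destruct (alg_bounded g Ag) as [N [HN BN]].
  destruct Af as [Cf Hf]. destruct Ag as [Cg Hg].
  split; [now apply cont_mult|]. intros eps He.
  destruct (mult_modulus M N eps HM HN He) as [d [Hd [_ Hde]]].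
  destruct (Hf d) as [p Hp]; [lra|]. destruct (Hg d) as [q Hq]; [lra|].
  exists (EMul p q). intros s. eapply Rle_lt_trans; [|exact Hde].
  apply mult_close; auto. lra.
Qed.

Lemma alg_minus (f g : K -> C) : alg f -> alg g -> alg (fun x => f x - g x)%C.
Proof.
  intros Af Ag.
  replace (fun x => f x - g x)%C with (fun x => f x + (-1) * g x)%C
    by (apply functional_extensionality; intros x; ring).
  apply alg_plus; trivial. apply alg_mult; trivial. apply alg_const.
Qed.

Lemma alg_limit (fn : nat -> K -> C) (f : K -> C) : (forall n, alg (fn n)) ->
  (forall eps, 0 < eps -> exists N, forall n x, (N <= n)%nat -> Cmod (fn n x - f x) < eps) ->
  alg f.
Proof.
  intros Hn Hl. split.
  - intros x eps He. destruct (Hl (eps / 3)) as [N HN]; [lra|].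
    destruct (proj1 (Hn N) x (eps / 3)) as [U [HU [Ux HUy]]]; [lra|].
    exists U. split; trivial. split; trivial. intros y Uy. specialize (HUy y Uy).
    assert (H1 := HN N x (Nat.le_refl N)). assert (H2 := HN N y (Nat.le_refl N)).
    replace (f y - f x)%C with
      (- (fn N y - f y) + ((fn N y - fn N x) + (fn N x - f x)))%C by ring.
    eapply Rle_lt_trans; [apply Cmod_triangle|]. rewrite Cmod_opp.
    assert (Tr := Cmod_triangle (fn N y - fn N x) (fn N x - f x)). lra.
  - intros eps He. destruct (Hl (eps / 2)) as [N HN]; [lra|].
    destruct (proj2 (Hn N) (eps / 2)) as [p Hp]; [lra|].
    exists p. intros s. specialize (Hp s). assert (H1 := HN N (e s) (Nat.le_refl N)).
    replace (f (e s) - ev s p)%C with (- (fn N (e s) - f (e s)) + (fn N (e s) - ev s p))%C by ring.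
    eapply Rle_lt_trans; [apply Cmod_triangle|]. rewrite Cmod_opp. lra.
Qed.

Lemma extend_z_exists (k : nat) : exists G, cont G /\ forall s, G (e s) = gz k (even_part s).
Proof.
  destruct (ev_bounded (EZ k)) as [M [_ H]].
  apply (extension _ M); [apply (ucont_even _ (ucont_gz k)) | exact H].
Qed.

Lemma extend_w_exists (m : nat) : exists G, cont G /\ forall s, G (e s) = gw m s.
Proof.
  destruct (ev_bounded (EW m)) as [M [_ H]].
  apply (extension _ M); [apply ucont_gw | exact H].
Qed.

Definition extend_z (k : nat) : K -> C :=
  proj1_sig (constructive_indefinite_description _ (extend_z_exists k)).

Definition extend_w (m : nat) : K -> C :=
  proj1_sig (constructive_indefinite_description _ (extend_w_exists m)).

Lemma extend_z_spec (k : nat) :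
  cont (extend_z k) /\ forall s, extend_z k (e s) = gz k (even_part s).
Proof. exact (proj2_sig (constructive_indefinite_description _ (extend_z_exists k))). Qed.

Lemma extend_w_spec (m : nat) :
  cont (extend_w m) /\ forall s, extend_w m (e s) = gw m s.
Proof. exact (proj2_sig (constructive_indefinite_description _ (extend_w_exists m))). Qed.

(** A representative in the algebra. The extensions of the generators are arbitrary choices, so
    relations such as [gw_sq] are guaranteed only on the image. *)
Definition extend (p : expr) (x : K) : C :=
  eval (fun k => extend_z k x) (fun m => extend_w m x) p.

Lemma extend_e (p : expr) (s : nat -> bool) : extend p (e s) = ev s p.
Proof.
  unfold extend, ev. f_equal; apply functional_extensionality; intros j.
  - apply extend_z_spec.
  - apply extend_w_spec.
Qed.

Lemma alg_extend (p : expr) : alg (extend p).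
Proof.
  split.
  - unfold extend. induction p; simpl.
    + apply cont_const.
    + apply extend_z_spec.
    + apply extend_w_spec.
    + now apply cont_plus.
    + now apply cont_mult.
  - intros eps He. exists p. intros s. rewrite extend_e.
    replace (ev s p - ev s p)%C with (RtoC 0) by ring. now rewrite Cmod_0.
Qed.

Lemma alg_RtoC_vanishing (u : K -> R) : rcont u -> (forall s, u (e s) = 0) ->
  alg (fun x => RtoC (u x)).
Proof.
  intros Hu H0. apply (alg_const_on_image _ 0); [now apply cont_RtoC|].
  intros s. now rewrite H0.
Qed.

(** A point off the image is told apart from any other by a bump vanishing on the image; two points
    of the image are told apart by generators. *)
Lemma alg_separates (x y : K) : x <> y -> exists f, alg f /\ f x <> f y.
Proof.
  assert (B : forall x y, x <> y -> (forall s, x <> e s) -> exists f, alg f /\ f x <> f y).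
  { clear x y. intros x y Hxy Hx. destruct (bump x y Hx Hxy) as [u [Hu [U1 [U0 Ue]]]].
    exists (fun x => RtoC (u x)). split; [now apply alg_RtoC_vanishing|].
    rewrite U1, U0. intros E. apply RtoC_inj in E. lra. }
  intros Hxy.
  destruct (classic (exists s, x = e s)) as [[s ->]|Hx].
  - destruct (classic (exists t, y = e t)) as [[t ->]|Hy].
    + apply NNPP. intros Hn. apply Hxy. f_equal. apply generators_separate.
      * intros k. apply NNPP. intros Hk. apply Hn. exists (extend (EZ k)).
        split; [apply alg_extend|]. now rewrite !extend_e.
      * intros m. apply NNPP. intros Hm. apply Hn. exists (extend (EW m)).
        split; [apply alg_extend|]. now rewrite !extend_e.
    + destruct (B y (e s)) as [f [Af Hf]].
      * now apply not_eq_sym.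
      * intros t E. apply Hy. now exists t.
      * exists f. split; trivial. now apply not_eq_sym.
  - apply B; trivial. intros s E. apply Hx. now exists s.
Qed.

Lemma alg_uniform_algebra : uniform_algebra T alg.
Proof.
  refine (conj _ (conj _ (conj _ (conj _ (conj _ _))))).
  - intros f [Hf _]. now apply continuousC_iff.
  - exact alg_const.
  - intros f g Hf Hg. now apply alg_plus.
  - intros f g Hf Hg. now apply alg_mult.
  - exact alg_separates.
  - intros fn f Hn Hl. apply (alg_limit fn); trivial.
    intros eps He. destruct (Hl eps He) as [N HN]. exists N. intros n x Hnx.
    specialize (HN n x Hnx). rewrite Cnorm_Cmod in HN. exact HN.
Qed.

(** * The character at the origin *)

(** The graph of the character at the origin. The inequality [ev0_le], applied to differences of
    approximating expressions, makes the value unique, and makes the approximations Cauchy, so that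
    it exists. *)
Definition limit_at_origin (f : K -> C) (c : C) : Prop := forall eps, 0 < eps ->
  exists p, (forall s, Cmod (f (e s) - ev s p) < eps) /\ Cmod (c - ev0 p) < eps.

Lemma limit_at_origin_unique (f : K -> C) (c d : C) :
  limit_at_origin f c -> limit_at_origin f d -> c = d.
Proof.
  intros Hc Hd. apply Ceq_of_small. intros eps He.
  destruct (Hc (eps / 4)) as [p [Hp Cp]]; [lra|]. destruct (Hd (eps / 4)) as [q [Hq Dq]]; [lra|].
  assert (B : Cmod (ev0 p - ev0 q) <= eps / 2).
  { replace (ev0 p - ev0 q)%C with (ev0 (ESub p q)) by apply eval_ESub.
    apply ev0_le. intros s. specialize (Hp s). specialize (Hq s).
    replace (ev s (ESub p q)) with (- (f (e s) - ev s p) + (f (e s) - ev s q))%C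
      by (unfold ev at 3; rewrite eval_ESub; unfold ev; ring).
    eapply Rle_trans; [apply Cmod_triangle|]. rewrite Cmod_opp. lra. }
  replace (c - d)%C with ((c - ev0 p) + ((ev0 p - ev0 q) + - (d - ev0 q)))%C by ring.
  eapply Rle_trans; [apply Cmod_triangle|].
  assert (Tr := Cmod_triangle (ev0 p - ev0 q) (- (d - ev0 q))). rewrite Cmod_opp in Tr. lra.
Qed.

Lemma limit_at_origin_exists (f : K -> C) : alg f -> exists c, limit_at_origin f c.
Proof.
  intros [_ Hf].
  assert (Hp : forall n, exists p, forall s, Cmod (f (e s) - ev s p) < (/ 2) ^ n).
  { intros n. apply Hf, pow_lt. lra. }
  set (p := fun n => proj1_sig (constructive_indefinite_description _ (Hp n))).
  assert (Ep : forall n s, Cmod (f (e s) - ev s (p n)) < (/ 2) ^ n).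
  { intros n. exact (proj2_sig (constructive_indefinite_description _ (Hp n))). }
  clearbody p. clear Hp.
  assert (Cau : forall n m, Cmod (ev0 (p n) - ev0 (p m)) <= (/ 2) ^ n + (/ 2) ^ m).
  { intros n m.
    replace (ev0 (p n) - ev0 (p m))%C with (ev0 (ESub (p n) (p m))) by apply eval_ESub.
    apply ev0_le. intros s. assert (H1 := Ep n s). assert (H2 := Ep m s).
    replace (ev s (ESub (p n) (p m))) with
      (- (f (e s) - ev s (p n)) + (f (e s) - ev s (p m)))%C
      by (unfold ev at 3; rewrite eval_ESub; unfold ev; ring).
    eapply Rle_trans; [apply Cmod_triangle|]. rewrite Cmod_opp. lra. }
  assert (Small : forall eps, 0 < eps -> exists N, forall n, (N <= n)%nat -> (/ 2) ^ n < eps).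
  { intros eps He. destruct (pow_half_small eps He) as [N HN]. exists N. intros n Hn.
    eapply Rle_lt_trans; [|exact HN]. rewrite !pow_inv.
    apply Rinv_le_contravar; [apply pow_lt; lra | apply Rle_pow; [lra | exact Hn]]. }
  assert (Conv : forall g : C -> R, (forall u v, Rabs (g u - g v) <= Cmod (u - v)) ->
    exists l, Un_cv (fun n => g (ev0 (p n))) l).
  { intros g Hg. destruct (Rcomplete.R_complete (fun n => g (ev0 (p n)))) as [l Hl]; [|now exists l].
    intros eps He. destruct (Small (eps / 2)) as [N HN]; [lra|]. exists N. intros n m Hn Hm.
    unfold Rdist. eapply Rle_lt_trans; [apply Hg|]. eapply Rle_lt_trans; [apply Cau|].
    assert (H1 := HN n Hn). assert (H2 := HN m Hm). lra. }
  destruct (Conv fst (fun u v => Cmod_fst (u - v)%C)) as [c1 H1].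
  destruct (Conv snd (fun u v => Cmod_snd (u - v)%C)) as [c2 H2].
  exists (c1, c2). intros eps He.
  destruct (H1 (eps / 2)) as [N1 K1]; [lra|]. destruct (H2 (eps / 2)) as [N2 K2]; [lra|].
  destruct (Small eps He) as [N3 K3].
  set (n := max N1 (max N2 N3)). exists (p n). split.
  - intros s. eapply Rlt_trans; [apply Ep | apply K3; lia].
  - rewrite Cmod_minus_sym. eapply Rle_lt_trans; [apply Cmod_le_sum|].
    specialize (K1 n ltac:(lia)). specialize (K2 n ltac:(lia)). unfold Rdist, Rminus in *.
    simpl. lra.
Qed.

Lemma limit_at_origin_const_on_image (f : K -> C) (c : C) :
  (forall s, f (e s) = c) -> limit_at_origin f c.
Proof.
  intros H eps He. exists (EC c).
  assert (E : Cmod (c - c) < eps)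
    by (replace (c - c)%C with (RtoC 0) by ring; now rewrite Cmod_0).
  split; trivial. intros s. rewrite H. exact E.
Qed.

Lemma limit_at_origin_plus (f g : K -> C) (c d : C) :
  limit_at_origin f c -> limit_at_origin g d -> limit_at_origin (fun x => f x + g x)%C (c + d)%C.
Proof.
  intros Hc Hd eps He.
  destruct (Hc (eps / 2)) as [p [Hp Cp]]; [lra|]. destruct (Hd (eps / 2)) as [q [Hq Dq]]; [lra|].
  exists (EAdd p q). split.
  - intros s. specialize (Hp s). specialize (Hq s).
    replace (ev s (EAdd p q)) with (ev s p + ev s q)%C by reflexivity.
    replace (_ - _)%C with ((f (e s) - ev s p) + (g (e s) - ev s q))%C by ring.
    eapply Rle_lt_trans; [apply Cmod_triangle | lra].
  - replace (ev0 (EAdd p q)) with (ev0 p + ev0 q)%C by reflexivity.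
    replace (_ - _)%C with ((c - ev0 p) + (d - ev0 q))%C by ring.
    eapply Rle_lt_trans; [apply Cmod_triangle | lra].
Qed.

Lemma limit_at_origin_mult (f g : K -> C) (c d : C) : alg f -> alg g ->
  limit_at_origin f c -> limit_at_origin g d -> limit_at_origin (fun x => f x * g x)%C (c * d)%C.
Proof.
  intros Af Ag Hc Hd eps He.
  destruct (alg_bounded f Af) as [M [HM BM]]. destruct (alg_bounded g Ag) as [N [HN BN]].
  assert (P1 := Cmod_ge_0 c). assert (P2 := Cmod_ge_0 d).
  destruct (mult_modulus (M + Cmod c) (N + Cmod d) eps) as [r [Hr [_ Hre]]]; try lra.
  destruct (Hc r) as [p [Hp Cp]]; [lra|]. destruct (Hd r) as [q [Hq Dq]]; [lra|].
  exists (EMul p q). split.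
  - intros s. specialize (BM s). specialize (BN s). eapply Rle_lt_trans; [|exact Hre].
    apply mult_close; auto; lra.
  - eapply Rle_lt_trans; [|exact Hre]. apply mult_close; auto; lra.
Qed.

Definition origin (f : K -> C) : C := epsilon (inhabits (RtoC 0)) (limit_at_origin f).

Lemma origin_spec (f : K -> C) : alg f -> limit_at_origin f (origin f).
Proof. intros H. unfold origin. apply epsilon_spec. now apply limit_at_origin_exists. Qed.

Lemma origin_eq (f : K -> C) (c : C) : alg f -> limit_at_origin f c -> origin f = c.
Proof. intros Hf Hc. apply (limit_at_origin_unique f); trivial. now apply origin_spec. Qed.

Lemma origin_character : character alg origin.
Proof.
  refine (conj _ (conj _ (conj _ _))).
  - intros f g Hf Hg. apply origin_eq; [now apply alg_plus|].
    apply limit_at_origin_plus; now apply origin_spec.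
  - intros c f Hf. apply origin_eq; [exact (alg_mult _ _ (alg_const c) Hf)|].
    apply (limit_at_origin_mult (fun _ => c)); trivial.
    + apply alg_const.
    + now apply limit_at_origin_const_on_image.
    + now apply origin_spec.
  - intros f g Hf Hg. apply origin_eq; [now apply alg_mult|].
    apply limit_at_origin_mult; trivial; now apply origin_spec.
  - exists (fun _ => RtoC 1). split; [apply alg_const|].
    rewrite (origin_eq _ (RtoC 1)).
    + intros E. apply (f_equal fst) in E. simpl in E. lra.
    + apply alg_const.
    + now apply limit_at_origin_const_on_image.
Qed.

(** At points of the image [z_0] has modulus 1, while the character sends it to 0. Off the image, a
    bump equal to 1 at [x] and vanishing on the image is sent to 0. *)
Lemma origin_not_point_evaluation : ~ is_point_evaluation alg origin.
Proof.
  intros [x Hx].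
  destruct (classic (exists s, x = e s)) as [[s ->]|Hn].
  - specialize (Hx (extend (EZ 0)) (alg_extend _)).
    rewrite (origin_eq _ 0), extend_e in Hx.
    + assert (E := f_equal Cmod Hx). unfold ev, eval in E. rewrite Cmod_gz, Cmod_0 in E.
      simpl in E. lra.
    + apply alg_extend.
    + intros eps He. exists (EZ 0). split.
      * intros s'. rewrite extend_e. replace (_ - _)%C with (RtoC 0) by ring.
        now rewrite Cmod_0.
      * unfold ev0, eval. replace (_ - _)%C with (RtoC 0) by ring. now rewrite Cmod_0.
  - assert (Hxs : forall s, x <> e s) by (intros s E; apply Hn; now exists s).
    (* The second point required by [bump] is taken on the image, where the bump vanishes anyway. *)
    destruct (bump x (e (fun _ => true)) Hxs (Hxs _)) as [u [Hu [U1 [_ Ue]]]].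
    assert (Au := alg_RtoC_vanishing u Hu Ue).
    specialize (Hx _ Au). rewrite (origin_eq _ 0), U1 in Hx; trivial.
    + apply (f_equal fst) in Hx. simpl in Hx. lra.
    + apply limit_at_origin_const_on_image. intros s. now rewrite Ue.
Qed.

(** * Characters and analytic discs *)

Section Characters.

Variable psi : (K -> C) -> C.
Hypothesis Hpsi : character alg psi.

Lemma char_plus (f g : K -> C) : alg f -> alg g ->
  psi (fun x => f x + g x)%C = (psi f + psi g)%C.
Proof. apply Hpsi. Qed.

Lemma char_mult (f g : K -> C) : alg f -> alg g ->
  psi (fun x => f x * g x)%C = (psi f * psi g)%C.
Proof. apply Hpsi. Qed.

Lemma char_scal (c : C) (f : K -> C) : alg f -> psi (fun x => c * f x)%C = (c * psi f)%C.
Proof. apply Hpsi. Qed.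

Lemma char_const (c : C) : psi (fun _ => c) = c.
Proof.
  assert (H1 : psi (fun _ => RtoC 1) = 1).
  { destruct Hpsi as [_ [_ [_ [f [Af Hf]]]]]. change (psi f <> 0) in Hf.
    assert (E := char_mult (fun _ => RtoC 1) f (alg_const 1) Af).
    cbv beta in E. rewrite (char_scal 1 f Af) in E.
    replace (psi (fun _ => RtoC 1)) with (psi (fun _ => RtoC 1) * psi f / psi f)%C
      by (field; exact Hf).
    rewrite <- E. field. exact Hf. }
  assert (E := char_scal c (fun _ => RtoC 1) (alg_const 1)).
  rewrite H1, Cmult_1_r in E. exact E.
Qed.

Lemma char_minus (f g : K -> C) : alg f -> alg g ->
  psi (fun x => f x - g x)%C = (psi f - psi g)%C.
Proof.
  intros Af Ag.
  replace (fun x => f x - g x)%C with (fun x => f x + (-1) * g x)%C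
    by (apply functional_extensionality; intros x; ring).
  rewrite char_plus, char_scal; trivial; [ring|].
  exact (alg_mult _ _ (alg_const _) Ag).
Qed.

Lemma char_neq_0 (f h : K -> C) : alg f -> alg h -> (forall x, (f x * h x)%C = 1) -> psi f <> 0.
Proof.
  intros Af Ah H E.
  assert (Q := char_mult f h Af Ah).
  replace (fun x => f x * h x)%C with (fun _ : K => RtoC 1) in Q
    by (apply functional_extensionality; intros x; now rewrite H).
  rewrite char_const, E, Cmult_0_l in Q. apply RtoC_inj in Q. lra.
Qed.

(* If [|psi f| > sup |f|], then [1 - f / psi f] is invertible by a geometric series
   although [psi] annihilates it. *)
Lemma char_bound (f : K -> C) (M : R) : alg f -> (forall x, Cmod (f x) <= M) -> Cmod (psi f) <= M.
Proof.
  intros Af HM. destruct (Rle_or_lt (Cmod (psi f)) M) as [|Hlt]; trivial. exfalso.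
  set (lam := psi f) in *.
  assert (PM : 0 <= M)
    by (eapply Rle_trans; [apply Cmod_ge_0 | apply (HM (e (fun _ => true)))]).
  assert (Pl : 0 < Cmod lam) by lra.
  assert (Hl : lam <> 0) by now apply Cmod_gt_0.
  set (g := fun x => (/ lam * f x)%C).
  assert (Ag : alg g) by exact (alg_mult _ _ (alg_const (/ lam)) Af).
  set (q := M / Cmod lam).
  assert (Hq0 : 0 <= q) by (apply Rdiv_le_0_compat; lra).
  assert (Hq1 : q < 1).
  { unfold q. apply Rmult_lt_reg_r with (Cmod lam); trivial.
    unfold Rdiv. rewrite Rmult_assoc, Rinv_l by lra. lra. }
  assert (Hg : forall x, Cmod (g x) <= q).
  { intros x. unfold g, q. rewrite Cmod_mult, Cmod_inv by exact Hl.
    unfold Rdiv. rewrite Rmult_comm. apply Rmult_le_compat_r; [|apply HM].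
    left. now apply Rinv_0_lt_compat. }
  assert (Hg1 : forall x, 1 - q <= Cmod (1 - g x)).
  { intros x. assert (R := Cmod_triangle_rev 1 (g x)). rewrite Cmod_1 in R.
    specialize (Hg x). lra. }
  assert (Hn : forall x, (1 - g x)%C <> 0).
  { intros x E. specialize (Hg1 x). rewrite E, Cmod_0 in Hg1. lra. }
  set (S := fix S n := match n with
    O => fun _ : K => RtoC 0 | Datatypes.S n => fun x => (1 + g x * S n x)%C end).
  assert (AS : forall n, alg (S n)).
  { induction n as [|n IH]; simpl; [apply alg_const|].
    apply (alg_plus (fun _ => RtoC 1)); [apply alg_const | now apply alg_mult]. }
  assert (Ah : alg (fun x => / (1 - g x))%C).
  { apply (alg_limit S); trivial. intros eps He.
    assert (ES : forall n x, Cmod (S n x - / (1 - g x)) <= q ^ n * / (1 - q)).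
    { induction n as [|n IH]; intros x; simpl.
      - replace (0 - / (1 - g x))%C with (- / (1 - g x))%C by ring.
        rewrite Cmod_opp, Cmod_inv, Rmult_1_l by apply Hn.
        apply Rinv_le_contravar; [lra | apply Hg1].
      - replace (1 + g x * S n x - / (1 - g x))%C with (g x * (S n x - / (1 - g x)))%C
          by (field; apply Hn).
        rewrite Cmod_mult, Rmult_assoc.
        apply Rmult_le_compat; auto using Cmod_ge_0. }
    destruct (pow_lt_1_zero q) with (y := eps * (1 - q)) as [N HN].
    - rewrite Rabs_right; lra.
    - apply Rmult_lt_0_compat; lra.
    - exists N. intros n x Hnx. specialize (HN n Hnx).
      rewrite Rabs_right in HN by (apply Rle_ge, pow_le; lra).
      eapply Rle_lt_trans; [apply ES|].
      apply Rmult_lt_reg_r with (1 - q); [lra|].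
      rewrite Rmult_assoc, Rinv_l by lra. lra. }
  apply (char_neq_0 (fun x => 1 - g x)%C (fun x => / (1 - g x))%C).
  - apply (alg_minus (fun _ => RtoC 1)); [apply alg_const | exact Ag].
  - exact Ah.
  - intros x. apply Cinv_r, Hn.
  - rewrite (char_minus (fun _ => RtoC 1)), char_const; trivial; [|apply alg_const].
    unfold g. rewrite char_scal by exact Af. fold lam. rewrite Cinv_l by exact Hl. ring.
Qed.

(** If the value [lam] were not real, [u - lam] would have no zero. Its inverse is constant on the
    image, hence in the algebra, although [psi] annihilates [u - lam]. *)
Lemma char_real (u : K -> R) : rcont u -> (forall s, u (e s) = 0) ->
  snd (psi (fun x => RtoC (u x))) = 0.
Proof.
  intros Hu H0. apply NNPP. intros Hs.
  assert (Au := alg_RtoC_vanishing u Hu H0).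
  set (lam := psi (fun x => RtoC (u x))) in *.
  assert (Hn : forall x, (RtoC (u x) - lam)%C <> 0).
  { intros x E. apply (f_equal snd) in E. simpl in E. lra. }
  assert (Ad : alg (fun x => RtoC (u x) - lam)%C)
    by (apply (alg_minus _ (fun _ => lam)); [exact Au | apply alg_const]).
  apply (char_neq_0 (fun x => RtoC (u x) - lam)%C (fun x => / (RtoC (u x) - lam))%C).
  - exact Ad.
  - apply (alg_const_on_image _ (/ (0 - lam))%C).
    + apply cont_inv; [apply Ad | exact Hn].
    + intros s. now rewrite H0.
  - intros x. apply Cinv_r, Hn.
  - rewrite (char_minus _ (fun _ => lam)), char_const; trivial; [|apply alg_const].
    fold lam. ring.
Qed.

(** * Characters determined by restriction to the Cantor set *)

Definition clamp (r t : R) : R := Rmax (- r) (Rmin r t).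

Lemma clamp_lipschitz (r t t' : R) : Rabs (clamp r t - clamp r t') <= Rabs (t - t').
Proof.
  unfold clamp, Rmax, Rmin.
  repeat destruct Rle_dec; unfold Rabs; repeat destruct Rcase_abs; lra.
Qed.

Lemma clamp_id (r t : R) : Rabs t <= r -> clamp r t = t.
Proof.
  intros H. apply Rabs_le_between in H. unfold clamp.
  rewrite Rmin_right, Rmax_right; lra.
Qed.

Lemma clamp_bound (r t : R) : 0 <= r -> Rabs (clamp r t) <= r.
Proof.
  intros H. apply Rabs_le. unfold clamp. split; [apply Rmax_l|].
  apply Rmax_lub; [lra | apply Rmin_l].
Qed.

Hypothesis Hvanish : forall f, cont f -> (forall s, f (e s) = 0) -> psi f = 0.

Lemma char_eq_on_image (f g : K -> C) : alg f -> alg g ->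
  (forall s, f (e s) = g (e s)) -> psi f = psi g.
Proof.
  intros Af Ag H.
  assert (E : psi (fun x => f x - g x)%C = 0).
  { apply Hvanish; [apply (alg_minus f g Af Ag)|]. intros s. rewrite H. ring. }
  rewrite char_minus in E by assumption.
  replace (psi f) with (psi f - psi g + psi g)%C by ring. rewrite E. ring.
Qed.

(** Clamping both coordinates to [[-r, r]] leaves [h] unchanged on the image, hence also its value
    under [psi], and bounds it on all of [K]. The factor 2 comes from adding the two coordinates. *)
Lemma char_bound_image (h : K -> C) (r : R) : alg h -> (forall s, Cmod (h (e s)) <= r) ->
  Cmod (psi h) <= 2 * r.
Proof.
  intros Ah Hr.
  assert (Pr : 0 <= r) by (eapply Rle_trans; [apply Cmod_ge_0 | apply (Hr (fun _ => true))]).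
  set (h' := fun x => (clamp r (fst (h x)), clamp r (snd (h x))) : C).
  assert (E : forall s, h' (e s) = h (e s)).
  { intros s. unfold h'. rewrite !clamp_id; [now destruct (h (e s)) | |].
    - eapply Rle_trans; [apply Cmod_snd | apply Hr].
    - eapply Rle_trans; [apply Cmod_fst | apply Hr]. }
  assert (Ah' : alg h').
  { destruct Ah as [Ch Hh]. split.
    - apply cont_pair.
      + apply (rcont_proj h (fun u => clamp r (fst u))); trivial. intros u v.
        eapply Rle_trans; [apply clamp_lipschitz | apply (Cmod_fst (u - v)%C)].
      + apply (rcont_proj h (fun u => clamp r (snd u))); trivial. intros u v.
        eapply Rle_trans; [apply clamp_lipschitz | apply (Cmod_snd (u - v)%C)].
    - intros eps He. destruct (Hh eps He) as [p Hp]. exists p. intros s. now rewrite E. }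
  rewrite (char_eq_on_image h h'); trivial; [|intros s; now rewrite E].
  apply char_bound; trivial. intros x.
  eapply Rle_trans; [apply Cmod_le_sum|]. unfold h'; simpl.
  assert (B1 := clamp_bound r (fst (h x)) Pr). assert (B2 := clamp_bound r (snd (h x)) Pr). lra.
Qed.

End Characters.

(** * Constancy along an analytic disc *)

Section Discs.

Variable sigma : C -> (K -> C) -> C.
Hypothesis sigma_char : forall z, Cmod z < 1 -> character alg (sigma z).
Hypothesis sigma_holo : forall f, alg f -> holomorphic_on_disc (fun z => sigma z f).

Lemma disc_const_of_deriv (f : K -> C) : alg f ->
  (forall z l, Cmod z < 1 -> cderiv (fun z => sigma z f) z l -> l = 0) ->
  forall z, Cmod z < 1 -> sigma z f = sigma 0 f.
Proof.
  intros Af H. apply (cderiv_0_const (fun z => sigma z f)). intros z Hz.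
  destruct (holomorphic_cderiv _ z (sigma_holo f Af) Hz) as [l Hl].
  now rewrite (H z l Hz Hl) in Hl.
Qed.

(** The real and imaginary parts of [f] vanish on the image as well; by [char_real] their transforms
    are real valued along the disc, so their derivatives are 0. *)
Lemma disc_const_vanishing (f : K -> C) : cont f -> (forall s, f (e s) = 0) ->
  forall z, Cmod z < 1 -> sigma z f = sigma 0 f.
Proof.
  intros Cf H0.
  assert (Hc : forall c : C -> R, (forall u v, Rabs (c u - c v) <= Cmod (u - v)) -> c 0 = 0 ->
    alg (fun x => RtoC (c (f x))) /\
    forall z, Cmod z < 1 -> sigma z (fun x => RtoC (c (f x))) = sigma 0 (fun x => RtoC (c (f x)))).
  { intros c Hc Hc0.
    assert (Rc : rcont (fun x => c (f x))) by now apply rcont_proj.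
    assert (Ec : forall s, c (f (e s)) = 0) by (intros s; now rewrite H0).
    assert (Ac := alg_RtoC_vanishing _ Rc Ec). split; trivial.
    apply disc_const_of_deriv; trivial. intros z l Hz. apply cderiv_real_0; trivial.
    intros w Hw. apply (char_real (sigma w)); auto. }
  destruct (Hc fst (fun u v => Cmod_fst (u - v)%C) eq_refl) as [A1 E1].
  destruct (Hc snd (fun u v => Cmod_snd (u - v)%C) eq_refl) as [A2 E2].
  intros z Hz. assert (Hz0 : Cmod 0 < 1) by (rewrite Cmod_0; lra).
  replace f with (fun x => RtoC (fst (f x)) + Ci * RtoC (snd (f x)))%C.
  - assert (A3 : alg (fun x => Ci * RtoC (snd (f x)))%C)
      by exact (alg_mult _ _ (alg_const Ci) A2).
    rewrite (char_plus (sigma z)), (char_plus (sigma 0)), (char_scal (sigma z)),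
      (char_scal (sigma 0)), E1, E2; auto.
  - apply functional_extensionality. intros x. destruct (f x) as [a b].
    unfold Cplus, Cmult, Ci, RtoC; simpl. f_equal; ring.
Qed.

Lemma disc_const (f : K -> C) : alg f -> forall z, Cmod z < 1 -> sigma z f = sigma 0 f.
Proof.
  intros Af z Hz. assert (Hz0 : Cmod 0 < 1) by (rewrite Cmod_0; lra).
  destruct (classic (exists u, cont u /\ (forall s, u (e s) = 0) /\ sigma 0 u <> 0))
    as [[u [Cu [U0 Un]]]|Hno].
  - assert (Au := alg_const_on_image u 0 Cu U0).
    (* The product with [u] also vanishes on the image, so it is constant along the disc; division
       by the nonzero constant [sigma 0 u] gives the claim for [f]. *)
    assert (E : sigma z (fun x => u x * f x)%C = sigma 0 (fun x => u x * f x)%C).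
    { apply disc_const_vanishing; trivial; [now apply cont_mult; [|apply Af]|].
      intros s. rewrite U0. ring. }
    rewrite (char_mult (sigma z)), (char_mult (sigma 0)) in E; auto.
    rewrite (disc_const_vanishing u Cu U0 z Hz) in E.
    replace (sigma z f) with (sigma 0 u * sigma z f / sigma 0 u)%C by (field; exact Un).
    rewrite E. field. exact Un.
  (* Now every character of the disc annihilates the functions vanishing on the image, and therefore
     respects relations that hold only there. *)
  - assert (Hv : forall w, Cmod w < 1 ->
      forall u, cont u -> (forall s, u (e s) = 0) -> sigma w u = 0).
    { intros w Hw u Cu U0. rewrite (disc_const_vanishing u Cu U0 w Hw).
      apply NNPP. intros Hn. apply Hno. now exists u. }
    clear Hno.
    assert (Hroot : forall m w, Cmod w < 1 ->
      (sigma w (extend (EW m)) * sigma w (extend (EW m)) =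
       sigma w (extend (EZ (base m))) - center m)%C).
    { intros m w Hw. rewrite <- (char_mult (sigma w)) by auto using alg_extend.
      rewrite <- (char_const (sigma w) (sigma_char w Hw) (center m)) at 1.
      rewrite <- (char_minus (sigma w)) by auto using alg_extend, alg_const.
      apply (char_eq_on_image (sigma w)); auto.
      - apply alg_mult; apply alg_extend.
      - apply (alg_minus _ (fun _ => center m)); [apply alg_extend | apply alg_const].
      - intros s. rewrite !extend_e. apply gw_sq. }
    assert (Hz_const : forall k w, Cmod w < 1 -> sigma w (extend (EZ k)) = sigma 0 (extend (EZ k))).
    { intros k. apply disc_const_of_deriv; [apply alg_extend|].
      intros z0 l Hz1 Hl. apply NNPP. intros Hl0.
      destruct (no_local_root _ _ _ Hz1 Hl Hl0) as [eta [He Hno]].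
      destruct (branch_point_dense (sigma z0 (extend (EZ k))) eta He) as [j Hj].
      (* The index of the square root of [z_k] minus a branch point within [eta] of the value at
         [z0]. *)
      set (m := to_nat (k, j)).
      assert (Eb : base m = k) by (unfold base, m; now rewrite cancel_of_to).
      assert (Ec : center m = branch_point j) by (unfold center, m; now rewrite cancel_of_to).
      apply (Hno (center m) (fun w => sigma w (extend (EW m)))).
      - now rewrite Ec.
      - intros w Hw.
        destruct (holomorphic_cderiv _ w (sigma_holo _ (alg_extend (EW m))) Hw) as [l' Hl'].
        exact (cderiv_ccont _ _ _ Hl').
      - intros w Hw. rewrite <- Eb. now apply Hroot. }
    assert (Hw_const : forall m w, Cmod w < 1 -> sigma w (extend (EW m)) = sigma 0 (extend (EW m))).
    { intros m. apply disc_const_of_deriv; [apply alg_extend|].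
      intros z0 l Hz1 Hl.
      (* Since the [z_k] are constant by now, this is a holomorphic square root of a constant. *)
      apply (cderiv_sq_const (fun w => sigma w (extend (EW m)))
        (sigma 0 (extend (EZ (base m))) - center m)%C z0 l Hz1); trivial.
      intros w Hw. rewrite Hroot by exact Hw. now rewrite Hz_const. }
    assert (Hp_const : forall p, sigma z (extend p) = sigma 0 (extend p)).
    { induction p as [c|k|m|p IHp q IHq|p IHp q IHq].
      - change (sigma z (fun _ => c) = sigma 0 (fun _ => c)).
        rewrite (char_const (sigma z)), (char_const (sigma 0)); auto.
      - auto.
      - auto.
      - change (sigma z (fun x => extend p x + extend q x)%C =
          sigma 0 (fun x => extend p x + extend q x)%C).
        rewrite (char_plus (sigma z)), (char_plus (sigma 0)), IHp, IHq; auto using alg_extend.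
      - change (sigma z (fun x => extend p x * extend q x)%C =
          sigma 0 (fun x => extend p x * extend q x)%C).
        rewrite (char_mult (sigma z)), (char_mult (sigma 0)), IHp, IHq; auto using alg_extend. }
    apply Ceq_of_small. intros eps He.
    (* [char_bound_image] doubles the error, and the comparison is made at [z] and at 0, which uses
       up four times [eps / 4]. *)
    destruct (proj2 Af (eps / 4)) as [p Hp]; [lra|].
    assert (B : forall w, Cmod w < 1 -> Cmod (sigma w f - sigma w (extend p)) <= eps / 2).
    { intros w Hw. rewrite <- (char_minus (sigma w)) by auto using alg_extend.
      replace (eps / 2) with (2 * (eps / 4)) by field.
      apply (char_bound_image (sigma w)); auto.
      - apply alg_minus; auto using alg_extend.
      - intros s. rewrite extend_e. left. apply Hp. }
    assert (B1 := B z Hz). assert (B2 := B 0 Hz0). rewrite Hp_const in B1.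
    replace (sigma z f - sigma 0 f)%C with
      ((sigma z f - sigma 0 (extend p)) + - (sigma 0 f - sigma 0 (extend p)))%C by ring.
    eapply Rle_trans; [apply Cmod_triangle|]. rewrite Cmod_opp. lra.
Qed.

End Discs.

Lemma alg_no_analytic_disc (sigma : C -> (K -> C) -> C) : ~ analytic_disc alg sigma.
Proof.
  intros [Hc [Hinj Hh]].
  assert (Hin : forall z : C, Cmod z < 1 -> in_disc z)
    by (intros z Hz; unfold in_disc; now rewrite Cnorm_Cmod).
  assert (H0 : Cmod 0 < 1) by (rewrite Cmod_0; lra).
  assert (H1 : Cmod (/ 2)%R < 1) by (rewrite Cmod_R, Rabs_right; lra).
  assert (E : RtoC (/ 2) = RtoC 0).
  { apply Hinj; auto. intros f Af. apply disc_const; auto. }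
  apply RtoC_inj in E. lra.
Qed.

End Algebra.

Theorem theorem1p8 (K : Type) (T : (K -> Prop) -> Prop)
  (HT : is_topology T) (Hcomp : compact_space T) (Hhaus : hausdorff T)
  (Hcantor : contains_cantor_set T) :
  exists A : (K -> Cpx) -> Prop,
    uniform_algebra T A /\
    (exists phi, character A phi /\ ~ is_point_evaluation A phi) /\
    (forall sigma : Cpx -> (K -> Cpx) -> Cpx, ~ analytic_disc A sigma).
Proof.
  destruct Hcantor as [e [e_cont [e_inj e_emb]]].
  exists (alg K T e). split; [|split].
  - now apply alg_uniform_algebra.
  - exists (origin K e). split.
    + now apply origin_character.
    + now apply origin_not_point_evaluation.
  - now apply alg_no_analytic_disc.
Qed.
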